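(* Let $(\Omega,\mathcal{F},P)$ be a probability space, let $(B,\|\cdot\|)$ be a Banach space over $K$ (where $K=\mathbb{R}$ or $K=\mathbb{C}$), and let $V$ be a nonempty closed convex subset of $B$. Let $L^0(\mathcal{F},V)\subset L^0(\mathcal{F},B)$ be the set of equivalence classes of $V$-valued strong $\mathcal{F}$-random elements on $(\Omega,\mathcal{F},P)$. Then $L^0(\mathcal{F},V)$ is an $L^0$-convexly compact subset of $L^0(\mathcal{F},B)$ if and only if $V$ is weakly compact.
   Context: Random elements: for a metric space $M$, a map $X:\Omega\to M$ is an $\mathcal{F}$-random element if $X^{-1}(G)\in\mathcal{F}$ for every open $G\subset M$; it is simple if in addition it takes only finitely many values; it is a strong $\mathcal{F}$-random element if it is the pointwise limit of a sequence of simple random elements (equivalently, it is a random element with separable range). Two random elements are equivalent if they agree $P$-almost everywhere. $L^0(\mathcal{F},K)$ is the algebra of equivalence classes of $K$-valued $\mathcal{F}$-measurable random variables on $(\Omega,\mathcal{F},P)$, $L^0(\mathcal{F})=L^0(\mathcal{F},\mathbb{R})$, ordered by $\xi\le\eta$ iff $\xi^0\le\eta^0$ $P$-a.s. for representatives $\xi^0,\eta^0$, and $L^0_+(\mathcal{F})=\{\xi\in L^0(\mathcal{F}):\xi\ge 0\}$. $L^0(\mathcal{F},B)$ is the set of equivalence classes of $B$-valued strong $\mathcal{F}$-random elements on $\Omega$. It is an $L^0(\mathcal{F},K)$-module under pointwise operations ($\xi x$ is the class of $\omega\mapsto\xi^0(\omega)x^0(\omega)$), with the $L^0$-norm $\|x\|:=$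 the class of $\omega\mapsto\|x^0(\omega)\|$ in $L^0_+(\mathcal{F})$, where $x^0$ is a representative of $x$. It is endowed with the $(\varepsilon,\lambda)$-topology, the linear topology with local base at $0$ given by the sets $\{x: P\{\omega:\|x\|(\omega)<\varepsilon\}>1-\lambda\}$, $\varepsilon>0$, $0<\lambda<1$; this is the topology of convergence in probability. ''Closed'' for subsets of $L^0(\mathcal{F},B)$ refers to this topology. A subset $G$ of $L^0(\mathcal{F},B)$ is $L^0$-convex if $\xi x+\eta y\in G$ for all $x,y\in G$ and all $\xi,\eta\in L^0_+(\mathcal{F})$ with $\xi+\eta=1$. A nonempty $L^0$-convex set $G$ is $L^0$-convexly compact if any family of nonempty closed $L^0$-convex subsets of $G$ having the finite intersection property (every finite subfamily has nonempty intersection) has nonempty intersection. $V$ is weakly compact if it is compact in the weak topology of $B$. *)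

(* Defs.v *)
From HB Require Import structures.
From mathcomp Require Import all_boot all_order all_algebra.
From mathcomp Require Import all_classical all_reals all_analysis.
From mathcomp Require Import measurable_realfun complex ring lra.

Set Implicit Arguments.
Unset Strict Implicit.
Unset Printing Implicit Defensive.
Import Order.TTheory GRing.Theory Num.Theory.
Import numFieldNormedType.Exports HBSimple.
Local Open Scope classical_set_scope.
Local Open Scope ring_scope.
Local Open Scope quotient_scope.

(* The scalar field K is either R or C = R[i]. The norm of a normed space over *)
(* K takes values in K, so real numbers are compared with norms through        *)
(* [of_real]; in R[i], z < w forces w - z to be real, so `|b| < of_real k e is *)
(* the usual comparison of real numbers.                                       *)
Variant scalar_kind := RealScalars | ComplexScalars.

Definition scalar_field (R : realType) (k : scalar_kind) : numFieldType :=
  match k with RealScalars => R | ComplexScalars => R[i]%C end.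

Definition of_real (R : realType) (k : scalar_kind) : R -> scalar_field R k :=
  match k return R -> scalar_field R k with
  | RealScalars => fun t => t
  | ComplexScalars => fun t => (t%:C)%C
  end.
Arguments of_real {R} k t.

Section scalar_lemmas.
Context (R : realType) (k : scalar_kind).
Implicit Types t u : R.

Lemma of_realD t u : of_real k (t + u) = of_real k t + of_real k u.
Proof. by case: k => //=; rewrite rmorphD. Qed.

Lemma of_realB t u : of_real k (t - u) = of_real k t - of_real k u.
Proof. by case: k => //=; rewrite rmorphB. Qed.

Lemma ltr_of_real t u : (of_real k t < of_real k u) = (t < u).
Proof. by case: k => //=; rewrite ltcR. Qed.

Lemma ler_of_real t u : (of_real k t <= of_real k u) = (t <= u).
Proof. by case: k => //=; rewrite lecR. Qed.

Lemma of_real_gt0 t : (0 < of_real k t) = (0 < t).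
Proof. by case: k => //=; rewrite -[0]/(0%:C)%C ltcR. Qed.

Lemma norm_of_real t : `|of_real k t| = of_real k `|t|.
Proof.
by case: k => //=; rewrite normc_def /= expr0n /= addr0 sqrtr_sqr.
Qed.

Lemma of_real_small (e : scalar_field R k) : 0 < e ->
  exists2 t : R, 0 < t & of_real k t <= e.
Proof.
case: k e => /= e e0; first by exists e.
case: e e0 => a b; rewrite ltcE /= => /andP[/eqP b0 a0].
by exists a => //; rewrite lecE /= b0 lexx eqxx.
Qed.

Lemma continuous_of_real : continuous (of_real k : R -> scalar_field R k).
Proof.
move=> t; apply/cvgrPdist_lt => e /of_real_small[u u0 ue].
near=> s; rewrite -of_realB norm_of_real (lt_le_trans _ ue)// ltr_of_real.
near: s; exact: (@cvgr_dist_lt _ R).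
Unshelve. all: by end_near. Qed.

Lemma invS_small (e : scalar_field R k) : 0 < e ->
  exists m : nat, of_real k m.+1%:R^-1 < e.
Proof.
move=> /of_real_small[t t0 te].
have [m] := ltr_add_invr (t0 : 0 < t); rewrite add0r => mt.
by exists m; rewrite (lt_le_trans _ te)// ltr_of_real.
Qed.

End scalar_lemmas.

Section random_elements.
Context d (Omega : measurableType d).

Definition random_element (M : topologicalType) (X : Omega -> M) :=
  forall G : set M, open G -> measurable (X @^-1` G).

Definition simple_random_element (M : topologicalType) (X : Omega -> M) :=
  random_element X /\ finite_set (range X).

Definition strong_random_element (M : topologicalType) (X : Omega -> M) :=
  exists s : (Omega -> M)^nat,
    (forall n, simple_random_element (s n)) /\
    (forall w, s n w @[n --> \oo] --> X w).

Lemma finite_fibers_measurable T (X : Omega -> T) (G : set T) :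
  finite_set (range X) -> (forall y, measurable (X @^-1` [set y])) ->
  measurable (X @^-1` G).
Proof.
move=> fX mX.
have -> : X @^-1` G = \bigcup_(y in range X `&` G) (X @^-1` [set y]).
  apply/seteqP; split=> [w Gw|w [y [_ Gy]] /= ->//].
  by exists (X w) => //; split => //; exists w.
by apply: fin_bigcup_measurable => //; exact: finite_setIl.
Qed.

End random_elements.

Section strong_random_elements.
Context (R : realType) (k : scalar_kind).
Local Notation K := (scalar_field R k).
Context d (Omega : measurableType d) (B : normedModType K).
Implicit Types X Y : Omega -> B.

Lemma simple_fibers T (X : Omega -> B) (f : B -> T) (y : T) :
  simple_random_element X -> measurable ((f \o X) @^-1` [set y]).
Proof.
move=> [rX fX]; rewrite (_ : _ @^-1` _ = X @^-1` (f @^-1` [set y]))//.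
apply: finite_fibers_measurable => // z.
have -> : X @^-1` [set z] = ~` (X @^-1` (~` [set z])).
  by rewrite preimage_setC setCK.
apply/measurableC/rX/closed_openC/accessible_closed_set1.
exact/hausdorff_accessible/norm_hausdorff.
Qed.

Lemma simple_comp2 S T (f : S -> T -> B) (g : Omega -> S) (h : Omega -> T) :
  finite_set (range g) -> (forall y, measurable (g @^-1` [set y])) ->
  finite_set (range h) -> (forall y, measurable (h @^-1` [set y])) ->
  simple_random_element (fun w => f (g w) (h w)).
Proof.
move=> fg mg fh mh.
have fgh : finite_set (range (fun w => (g w, h w))).
  apply: (@sub_finite_set _ _ (range g `*` range h)).
    by move=> _ [w _ <-]; split; exists w.
  exact: finite_setX.
have mgh G : measurable ((fun w => (g w, h w)) @^-1` G).
  apply: finite_fibers_measurable => // -[a b].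
  rewrite (_ : _ @^-1` _ = g @^-1` [set a] `&` h @^-1` [set b]).
    exact: measurableI.
  by apply/seteqP; split=> [w /= [-> ->]|w /= [-> ->]].
split=> [G _|].
  exact: (mgh [set p | G (f p.1 p.2)]).
apply: sub_finite_set (finite_image (fun p => f p.1 p.2) fgh).
by move=> _ [w _ <-]; exists (g w, h w) => //; exists w.
Qed.

Lemma strong_random_elementW X :
  strong_random_element X -> random_element X.
Proof.
move=> [s [ss sX]] G oG.
pose H m := [set y : B | forall z, `|y - z| < of_real k m.+1%:R^-1 -> G z].
have -> : X @^-1` G =
    \bigcup_m \bigcup_N \bigcap_(n in [set n | (N <= n)%N]) (s n @^-1` H m).
  apply/seteqP; split=> [w /= Gw|w [m _] [N _] Hw] /=.
    have /nbhs_normP[e /= e0 eG] : nbhs (X w) G by exact: open_nbhs_nbhs.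
    have e20 : 0 < e / 2 by rewrite divr_gt0.
    have [m me] := invS_small e20.
    exists m => //.
    have m0 : 0 < of_real k (m.+1%:R^-1 : R).
      by rewrite of_real_gt0 invr_gt0.
    have /cvgrPdist_lt/(_ _ m0)[N _ HN] := sX w.
    exists N => // n /= Nn z zn; apply: eG => /=.
    rewrite (le_lt_trans (ler_distD (s n w) _ _))//.
    by rewrite (splitr e) ltrD// (lt_trans _ me)//; exact: HN.
  have m0 : 0 < of_real k (m.+1%:R^-1 : R).
    by rewrite of_real_gt0 invr_gt0.
  have /cvgrPdist_lt/(_ _ m0)[N' _ HN] := sX w.
  apply: (Hw (maxn N N')); first exact: leq_maxl.
  by rewrite distrC; apply: HN; exact: leq_maxr.
apply: bigcup_measurable => m _; apply: bigcup_measurable => N _.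
apply: bigcap_measurable; first by exists N => /=.
move=> n _; apply: finite_fibers_measurable; first exact: (ss n).2.
by move=> y; exact: (@simple_fibers _ (s n) id).
Qed.

Lemma strong_random_element_scale (xi : {mfun Omega >-> R}) X :
  strong_random_element X ->
  strong_random_element (fun w => of_real k (xi w) *: X w).
Proof.
move=> [s [ss sX]].
have mxi : measurable_fun setT (EFin \o (xi : Omega -> R)) by exact/measurable_EFinP.
have [g gxi] := approximation_sfun measurableT mxi.
exists (fun n w => of_real k (g n w) *: s n w); split=> [n|w].
  apply: (@simple_comp2 _ _ (fun a b => of_real k a *: b)).
  - exact: fimfunP.
  - by move=> y; exact: measurable_sfunP.
  - exact: (ss n).2.
  - by move=> y; exact: (@simple_fibers _ (s n) id).
have gw : g n w @[n --> \oo] --> (xi w : R) by exact: fine_cvg (gxi w I).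
apply: cvgZ => //; apply: (cvg_comp (g^~ w) (of_real k) gw).
exact: continuous_of_real.
Qed.

Definition strong_pred : {pred Omega -> B} :=
  [pred X | `[< strong_random_element X >]].

Lemma strong_zmod_closed : zmod_closed strong_pred.
Proof.
split=> [|X Y /asboolP[s [ss sX]] /asboolP[t [st tY]]]; apply/asboolP.
  exists (fun=> 0); split=> [n|w]; last exact: cvg_cst.
  have m1 (y : unit) : measurable ((fun _ : Omega => tt) @^-1` [set y]).
    by case: y; rewrite (_ : _ @^-1` _ = setT)//; apply/seteqP; split.
  apply: (@simple_comp2 unit unit (fun _ _ => 0) (fun=> tt) (fun=> tt)) => //;
    exact: finite_finset.
exists (fun n w => s n w - t n w); split=> [n|w]; last exact: cvgB.
apply: (@simple_comp2 _ _ (fun a b => a - b)).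
- exact: (ss n).2.
- by move=> y; exact: (@simple_fibers _ (s n) id).
- exact: (st n).2.
- by move=> y; exact: (@simple_fibers _ (t n) id).
Qed.

End strong_random_elements.

HB.instance Definition _ (R : realType) (k : scalar_kind) d
    (Omega : measurableType d) (B : normedModType (scalar_field R k)) :=
  GRing.isZmodClosed.Build (Omega -> B) (@strong_pred R k d Omega B)
    (@strong_zmod_closed R k d Omega B).

Section strong_type.
Context (R : realType) (k : scalar_kind) d (Omega : measurableType d).
Context (B : normedModType (scalar_field R k)).

(* Strong random elements themselves; elements of L0 are their classes modulo  *)
(* P-almost sure equality.                                                     *)
Record strong_elt := StrongElt {
  strong_fun :> Omega -> B;
  strong_funP : strong_fun \in @strong_pred R k d Omega B }.

HB.instance Definition _ := [isSub for strong_fun].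
HB.instance Definition _ := [Choice of strong_elt by <:].
HB.instance Definition _ := [SubChoice_isSubZmodule of strong_elt by <:].

Lemma strong_eltP (X : strong_elt) : strong_random_element X.
Proof. exact/asboolP/(strong_funP X). Qed.

Lemma strong_oppE (X : strong_elt) w : (- X) w = - X w.
Proof. by []. Qed.

Lemma strong_addE (X Y : strong_elt) w : (X + Y) w = X w + Y w.
Proof. by []. Qed.

Definition strong_scale (xi : {mfun Omega >-> R}) (X : strong_elt) : strong_elt :=
  StrongElt (asboolT (strong_random_element_scale xi (strong_eltP X))).

Lemma strong_scaleE (xi : {mfun Omega >-> R}) (X : strong_elt) w :
  strong_scale xi X w = of_real k (xi w) *: X w.
Proof. by []. Qed.

End strong_type.

Section L0_def.
Context (R : realType) (k : scalar_kind) d (Omega : measurableType d).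
Context (P : probability Omega R) (B : normedModType (scalar_field R k)).
Local Notation strong_elt := (strong_elt Omega B).

Definition strong_equiv (X Y : strong_elt) : bool := `[< X = Y %[ae P] >].

Lemma strong_equiv_refl : reflexive strong_equiv.
Proof. by move=> X; apply/asboolP; near=> w. Unshelve. all: by end_near. Qed.

Lemma strong_equiv_sym : symmetric strong_equiv.
Proof. by move=> X Y; apply/idP/idP => /asboolP h; apply/asboolP/ae_eq_sym. Qed.

Lemma strong_equiv_trans : transitive strong_equiv.
Proof.
by move=> X Y Z /asboolP YX /asboolP XZ; apply/asboolP/(ae_eq_trans YX XZ).
Qed.

Canonical strong_equiv_canonical :=
  EquivRel strong_equiv strong_equiv_refl strong_equiv_sym strong_equiv_trans.

Definition L0 : Type := {eq_quot strong_equiv}.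
HB.instance Definition _ := Choice.on L0.
HB.instance Definition _ := EqQuotient.on L0.

Lemma eq_L0P (X Y : strong_elt) : \pi_L0 X = \pi_L0 Y <-> X = Y %[ae P].
Proof.
by split=> [/eqP|h]; [rewrite piE => /asboolP|apply/eqP; rewrite piE; apply/asboolP].
Qed.

Lemma repr_L0 (X : strong_elt) : repr (\pi_L0 X) = X %[ae P].
Proof. by apply/eq_L0P; rewrite reprK. Qed.

(* An x : L0 has a chosen representative repr x. The operations below do not   *)
(* depend on that choice, see pi_L0_opp, pi_L0_add and pi_L0_scale.            *)
Definition L0_zero : L0 := \pi_L0 0.
Definition L0_opp (x : L0) : L0 := \pi_L0 (- repr x).
Definition L0_add (x y : L0) : L0 := \pi_L0 (repr x + repr y).

Lemma pi_L0_opp (X : strong_elt) : \pi_L0 (- X) = L0_opp (\pi_L0 X).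
Proof.
apply/eq_L0P; have := repr_L0 X; apply: filterS => w h _.
by rewrite !strong_oppE (h I).
Qed.

Lemma pi_L0_add (X Y : strong_elt) : \pi_L0 (X + Y) = L0_add (\pi_L0 X) (\pi_L0 Y).
Proof.
apply/eq_L0P; have := repr_L0 X; have := repr_L0 Y.
by apply: filterS2 => w h1 h2 _; rewrite !strong_addE (h1 I) (h2 I).
Qed.

Lemma L0_addA : associative L0_add.
Proof.
move=> x y z; apply/eq_L0P; have := repr_L0 (repr y + repr z).
have := repr_L0 (repr x + repr y); apply: filterS2 => w h1 h2 _.
by rewrite !strong_addE (h1 I) (h2 I) !strong_addE addrA.
Qed.

Lemma L0_addC : commutative L0_add.
Proof. by move=> x y; rewrite /L0_add addrC. Qed.

Lemma L0_add0 : left_id L0_zero L0_add.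
Proof.
move=> x; rewrite -[RHS]reprK; apply/eq_L0P; have := repr_L0 0.
by apply: filterS => w h _; rewrite strong_addE (h I) add0r.
Qed.

Lemma L0_addN : left_inverse L0_zero L0_opp L0_add.
Proof.
move=> x; apply/eq_L0P; have := repr_L0 (- repr x).
by apply: filterS => w h _; rewrite strong_addE (h I) strong_oppE addNr.
Qed.

HB.instance Definition _ :=
  GRing.isZmodule.Build L0 L0_addA L0_addC L0_add0 L0_addN.

(* {mfun_ P, Omega >-> R} is L^0(F, R); a real random variable acts on B       *)
(* through the inclusion of R in K.                                            *)
Definition L0_scale (xi : {mfun_ P, Omega >-> R}) (x : L0) : L0 :=
  \pi_L0 (strong_scale (repr xi) (repr x)).

Lemma pi_L0_scale (f : {mfun Omega >-> R}) X :
  \pi_L0 (strong_scale f X) = L0_scale (\pi_({mfun_ P, Omega >-> R}) f) (\pi_L0 X).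
Proof.
apply/eq_L0P; have := repr_L0 X.
have : repr (\pi_({mfun_ P, Omega >-> R}) f) = f %[ae P].
  by have /eqquotP/asboolP := reprK (\pi_({mfun_ P, Omega >-> R}) f).
by apply: filterS2 => w h1 h2 _; rewrite !strong_scaleE (h1 I) (h2 I).
Qed.

End L0_def.

Section epsilon_lambda_topology.
Context (R : realType) (k : scalar_kind) d (Omega : measurableType d).
Context (P : probability Omega R) (B : normedModType (scalar_field R k)).
Local Notation L0 := (L0 P B).

(* L0_nbhs0 e l is the set of x with P {w | ||x||(w) < e} > 1 - l, the basic   *)
(* neighbourhood of 0 in the (epsilon, lambda)-topology.                       *)
Definition L0_nbhs0 (e l : R) : set L0 :=
  [set x : L0 | ((1 - l)%:E < P [set w | `|repr x w| < of_real k e]%R)%E].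

Definition L0_nbhs (x : L0) : set_system L0 :=
  filter_from [set el : R * R | 0 < el.1 /\ 0 < el.2 < 1]
    (fun el => [set y | L0_nbhs0 el.1 el.2 (y - x)]).

Lemma measurable_small (X : strong_elt Omega B) (e : R) :
  measurable [set w | `|X w| < of_real k e].
Proof.
have -> : [set w | `|X w| < of_real k e] = X @^-1` ball (0 : B) (of_real k e).
  by apply/seteqP; split=> w /=; rewrite -ball_normE /= sub0r normrN.
exact/(strong_random_elementW (strong_eltP X))/ball_open.
Qed.

Lemma le_probability_ae (A C : set Omega) : measurable A -> measurable C ->
  {ae P, forall w, A w -> C w} -> (P A <= P C)%E.
Proof.
move=> mA mC [N [mN N0 AN]].
have AC : A `<=` C `|` N.
  move=> w Aw; have [Cw|nCw] := pselect (C w); first by left.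
  by right; apply: AN => /= /(_ Aw).
have mCN : measurable (C `|` N) by exact: measurableU.
apply: (le_trans (le_measure P (mem_set mA) (mem_set mCN) AC)).
by have := measureU2 P mC mN; rewrite [X in (_ + X)%E]N0 adde0.
Qed.

Lemma L0_nbhs0_le (e e' l l' : R) : e <= e' -> l <= l' ->
  L0_nbhs0 e l `<=` L0_nbhs0 e' l'.
Proof.
move=> ee ll x; rewrite /L0_nbhs0 /= => h.
have le1 : ((1 - l')%:E <= (1 - l)%:E)%E by rewrite lee_fin lerB.
apply: (le_lt_trans le1 (lt_le_trans h _)).
apply: le_measure; rewrite ?inE; try exact: measurable_small.
by move=> w /= /lt_le_trans; apply; rewrite ler_of_real.
Qed.

Lemma L0_nbhs0_0 (e l : R) : 0 < e -> 0 < l -> L0_nbhs0 e l 0.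
Proof.
move=> e0 l0; rewrite /L0_nbhs0 /=.
have : (P setT <= P [set w | (`|repr (0%R : L0) w| < of_real k e)%R])%E.
  apply: le_probability_ae => //; first exact: measurable_small.
  have := repr_L0 P (0 : strong_elt Omega B); apply: filterS => w h _ /=.
  by rewrite (h I) normr0 of_real_gt0.
by apply: lt_le_trans; rewrite probability_setT lte_fin ltrBlDr ltrDl.
Qed.

Lemma L0_nbhs0_D (e e' l l' : R) (x y : L0) :
  L0_nbhs0 e l x -> L0_nbhs0 e' l' y -> L0_nbhs0 (e + e') (l + l') (x + y).
Proof.
rewrite /L0_nbhs0 /=.
set A := [set w | _]; set A' := [set w | _]; set C := [set w | _].
have mA : measurable A by exact: measurable_small.
have mA' : measurable A' by exact: measurable_small.
have mC : measurable C by exact: measurable_small.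
have AC : (P (A `&` A') <= P C)%E.
  apply: le_probability_ae => //; first exact: measurableI.
  have := repr_L0 P (repr x + repr y); apply: filterS => w h [/= hx hy].
  rewrite /C /= (h I) strong_addE (le_lt_trans (ler_normD _ _))//.
  by rewrite of_realD ltrD.
have AA : (P (~` (A `&` A')) <= P (~` A) + P (~` A'))%E.
  by rewrite setCI measureU2//; exact: measurableC.
move: AA AC; rewrite !probability_setC//; last exact: measurableI.
have mAA : measurable (A `&` A') by exact: measurableI.
rewrite -(fineK (fin_num_measure P _ mA)) -(fineK (fin_num_measure P _ mA')).
rewrite -(fineK (fin_num_measure P _ mAA)) -(fineK (fin_num_measure P _ mC)).
rewrite -!EFinB -EFinD !lee_fin !lte_fin => h1 h2 h3 h4.
lra.
Qed.

Lemma L0_nbhs_filter (x : L0) : ProperFilter (L0_nbhs x).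
Proof.
apply: filter_from_proper; last first.
  by move=> [e l] [/= e0 /andP[l0 _]]; exists x; rewrite /= subrr; exact: L0_nbhs0_0.
apply: filter_from_filter => [|[e l] [e' l'] [/= e0 /andP[l0 l1]] [/= e0' /andP[l0' l1']]].
  by exists (1, 2^-1) => /=; split=> //; lra.
exists (Num.min e e', Num.min l l') => /=.
  by rewrite !lt_min e0 e0' l0 l0' gt_min l1.
move=> y /= h; split; apply: L0_nbhs0_le h; by rewrite ge_min lexx ?orbT.
Qed.

Lemma L0_nbhs_singleton (x : L0) (A : set L0) : L0_nbhs x A -> A x.
Proof.
move=> [[e l] [/= e0 /andP[l0 _]]]; apply; rewrite /= subrr.
exact: L0_nbhs0_0.
Qed.

Lemma L0_nbhs_nbhs (x : L0) (A : set L0) :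
  L0_nbhs x A -> L0_nbhs x (L0_nbhs^~ A).
Proof.
move=> [[e l] [/= e0 /andP[l0 l1]] elA].
have h2 : 0 < e / 2 /\ 0 < l / 2 < 1 by split; lra.
exists (e / 2, l / 2) => //= y yx; exists (e / 2, l / 2) => //= z zy.
apply: elA; rewrite /= (splitr e) (splitr l) -(subrKA y).
exact: L0_nbhs0_D.
Qed.

HB.instance Definition _ := hasNbhs.Build L0 L0_nbhs.
HB.instance Definition _ := Nbhs_isNbhsTopological.Build L0
  L0_nbhs_filter L0_nbhs_singleton L0_nbhs_nbhs.

End epsilon_lambda_topology.

Section L0_convexity.
Context (R : realType) (k : scalar_kind) d (Omega : measurableType d).
Context (P : probability Omega R) (B : normedModType (scalar_field R k)).
Local Notation L0 := (L0 P B).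

Definition L0_nonneg : set {mfun_ P, Omega >-> R} :=
  [set xi | {ae P, forall w, 0 <= xi w}].

Definition L0_convex (G : set L0) :=
  forall (x y : L0) (xi eta : {mfun_ P, Omega >-> R}),
    G x -> G y -> L0_nonneg xi -> L0_nonneg eta ->
    {ae P, forall w, xi w + eta w = 1} ->
    G (L0_scale xi x + L0_scale eta y).

Definition L0_convexly_compact (G : set L0) :=
  [/\ G !=set0, L0_convex G &
    forall F : set (set L0),
      (forall A, F A -> [/\ A !=set0, closed A, L0_convex A & A `<=` G]) ->
      finI F id -> \bigcap_(A in F) A !=set0].

Definition L0_valued (V : set B) : set L0 :=
  [set \pi_L0 X | X in [set X : strong_elt Omega B | forall w, V (X w)]].

End L0_convexity.
Arguments L0_valued {R k d Omega} P {B} V.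

Section weak_topology.
Context (K : numFieldType) (B : normedModType K).

(* The coarsest topology on B making every continuous linear functional        *)
(* continuous.                                                                 *)
Definition continuous_functional :=
  {f : {linear B -> K^o} | continuous (f : B -> K^o)}.

Definition weak_topology : topologicalType :=
  sup_topology (fun f : continuous_functional =>
    Topological.class (initial_topology (sval f : B -> K^o))).

Definition weakly_compact (V : set B) := compact (V : set weak_topology).

End weak_topology.

(* Main.v *)
(* If pi X belongs to L0_valued P C for every member C of a family of closed sets, *)
(* then the essential values of X belong to every such C (they are the points all  *)
(* of whose neighbourhoods X hits with positive probability, and exist because X   *)
(* has separable range). Applied to the closed convex members of an ultrafilter on *)
(* V, this yields its weak limit.                                                  *)
(*                                                                                *)
(* Conversely let V be weakly compact. For random elements x_n with values in V,  *)
(* choose contractions u_i norming a separable subspace that contains their       *)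
(* values. Near-minimizers z_n of the strictly convex functional                  *)
(* sum_i c_i E(u_i Z)^2 over the random elements with values in the closed convex *)
(* hulls of {x_m : m >= n} are Cauchy in mean square along every u_i, so that     *)
(* u_i(z_n) converges almost surely for a subsequence. A pointwise weak cluster   *)
(* point X of (z_n) is then measurable, and Mazur's lemma puts X(w) in the closed *)
(* convex hull of {x_m(w) : m >= n} for all n. By L0-convexity X belongs to every *)
(* closed L0-convex set that contains all but finitely many x_n. This settles     *)
(* countable families. For an arbitrary family close off under countable          *)
(* intersections, and for each of countably many Y fix a member at maximal mean   *)
(* distance from Y. The x_n are chosen so that these Y are dense around X; since  *)
(* no member of the family is farther from such Y than the fixed ones, which      *)
(* contain X, all members contain X.                                              *)
From HB Require Import structures.
From mathcomp Require Import all_boot all_order all_algebra.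
From mathcomp Require Import all_classical all_reals all_analysis.
From mathcomp Require Import measurable_realfun complex ring lra.
Require Import Defs.

Set Implicit Arguments.
Unset Strict Implicit.
Unset Printing Implicit Defensive.
Import Order.TTheory GRing.Theory Num.Theory.
Import numFieldNormedType.Exports HBSimple.
Local Open Scope classical_set_scope.
Local Open Scope ring_scope.
Local Open Scope quotient_scope.

(** * Real structure of the scalar field *)

(** From random elements to [V]: constants show that the sets [L0_valued P C], for closed convex [C]
    in an ultrafilter on [V], have the finite intersection property. An essential value
    ([essential_value]) of a common element lies in every such [C], and [weakly_compact_ultra]
    recognises it as the weak limit.

    From [V] to random elements the obstacle is measurability, since weak cluster points chosen
    separately for each [w] need not depend measurably on [w]. In [weak_limit] the sequence is first
    replaced by near-minimizers in the hulls of its tails, along which countably many norming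
    functionals converge; these functionals are then measurable at the cluster point, and [pettis]
    gives strong measurability. [admissible_hull] turns membership in pointwise hulls into
    membership in admissible sets, which settles countable families. For arbitrary families,
    [admissible_bigcap_nonempty] maximizes mean distances to countably many test elements and
    concludes with the pasting lemma [admissible_patch]. *)

Section real_part.
Context (R : realType) (k : scalar_kind).
Local Notation K := (scalar_field R k).
Implicit Types (s t : R) (z w : K).

Lemma of_real0 : of_real k 0 = 0 :> K. Proof. by case: k. Qed.
Lemma of_real1 : of_real k 1 = 1 :> K. Proof. by case: k. Qed.

Lemma of_realM s t : of_real k (s * t) = of_real k s * of_real k t.
Proof. by case: k => //=; rewrite rmorphM. Qed.

Lemma of_realN t : of_real k (- t) = - of_real k t.
Proof. by case: k => //=; rewrite rmorphN. Qed.

Definition real_part : K -> R :=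
  match k return scalar_field R k -> R with
  | RealScalars => id
  | ComplexScalars => @complex.Re R
  end.

Lemma real_part_of_real t : real_part (of_real k t) = t.
Proof. by rewrite /real_part; case: k. Qed.

Lemma real_partD z w : real_part (z + w) = real_part z + real_part w.
Proof. by rewrite /real_part; case: k z w => //= -[a b] [c e]. Qed.

Lemma real_partM t z : real_part (of_real k t * z) = t * real_part z.
Proof.
by rewrite /real_part; case: k z => //= -[a b] /=; rewrite mul0r subr0.
Qed.

Lemma real_part_norm z : of_real k (real_part `|z|) = `|z|.
Proof. by rewrite /real_part; case: k z => //= -[a b] /=. Qed.

Lemma real_part_le_norm z : real_part z <= real_part `|z|.
Proof.
rewrite -(ler_of_real k) real_part_norm.
rewrite /real_part; case: k z => [|z] /=; first exact: ler_norm.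
apply: le_trans (normc_ge_Re z); rewrite lecR; exact: ler_norm.
Qed.

Definition directions : seq K :=
  match k return seq (scalar_field R k) with
  | RealScalars => [:: 1; -1]
  | ComplexScalars => [:: 1; -1; 'i%C; - 'i%C]
  end.

(** For t > 0, if all of Re z, -Re z, Im z, -Im z were below t / 2, then |z|^2 would be below t^2 /
    2. So a disc contains a finite intersection of half-planes, which reduces weak neighbourhoods to
    half-spaces. *)
Lemma directionsP t z : of_real k t <= `|z| ->
  exists2 c, c \in directions & t / 2 <= real_part (c * z).
Proof.
have d1 : 1 \in directions by rewrite /directions; case: k; rewrite inE eqxx.
have dN1 : -1 \in directions.
  by rewrite /directions; case: k; rewrite !inE eqxx orbT.
have rN1 : real_part (-1 * z) = - real_part z.
  by rewrite -of_real1 -of_realN real_partM mulN1r.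
have [t0 _|t0] := leP t 0.
  have [h|h] := leP 0 (real_part z); first by exists 1 => //; rewrite mul1r; lra.
  by exists (-1) => //; rewrite rN1; lra.
clear d1 dN1 rN1.
rewrite /directions /real_part; case: k z => /= [z|[a b]].
  case: (lerP 0 z) => z0; [rewrite ger0_norm//|rewrite ltr0_norm//] => h.
    by exists 1; rewrite ?inE ?eqxx//; lra.
  by exists (-1); rewrite ?inE ?eqxx ?orbT//; lra.
move=> h; apply: contrapT => hn.
have h1 c : c \in [:: 1; -1; 'i%C; - 'i%C] -> 
    complex.Re (c * (a +i* b)%C)%R < t / 2.
  by move=> cd; rewrite ltNge; apply/negP => ct; apply: hn; exists c.
have := h1 1 _; rewrite !inE eqxx /= => /(_ isT).
have := h1 (-1) _; rewrite !inE eqxx /= orbT => /(_ isT).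
have := h1 'i%C _; rewrite !inE eqxx /= !orbT => /(_ isT).
have := h1 (-'i%C) _; rewrite !inE eqxx /= !orbT => /(_ isT).
move=> b1 b2 a1 a2.
have : t ^+ 2 <= a ^+ 2 + b ^+ 2.
  move: h; rewrite normc_def /= lecR => h.
  have ab0 : 0 <= a ^+ 2 + b ^+ 2 by rewrite addr_ge0// sqr_ge0.
  by rewrite -(sqr_sqrtr ab0) lerXn2r// nnegrE ?sqrtr_ge0// ltW.
by nra.
Qed.

End real_part.
Arguments directions R k : clear implicits.

(** * Hahn-Banach separation over the reals *)

Section real_norm.
Context (R : realType) (k : scalar_kind).
Local Notation K := (scalar_field R k).
Context (B : normedModType K).
Implicit Types (s t : R) (x y : B) (C : set B).

Definition nrm x : R := real_part `|x|.

Lemma of_real_nrm x : of_real k (nrm x) = `|x|.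
Proof. by rewrite /nrm -normr_id real_part_norm. Qed.

Lemma nrm_ge0 x : 0 <= nrm x.
Proof. by rewrite -(ler_of_real k) of_real_nrm of_real0. Qed.

Lemma nrmD x y : nrm (x + y) <= nrm x + nrm y.
Proof. by rewrite -(ler_of_real k) of_realD !of_real_nrm ler_normD. Qed.

Lemma nrmN x : nrm (- x) = nrm x.
Proof. by rewrite /nrm normrN. Qed.

Lemma nrm_distC x y : nrm (x - y) = nrm (y - x).
Proof. by rewrite /nrm distrC. Qed.

Lemma nrm0 : nrm 0 = 0.
Proof. by rewrite /nrm normr0 -(of_real0 R k) real_part_of_real. Qed.

Lemma nrmZ t x : nrm (of_real k t *: x) = `|t| * nrm x.
Proof. by rewrite /nrm normrZ norm_of_real real_partM. Qed.

Lemma nrmB_le x y z : nrm (x - z) <= nrm (x - y) + nrm (y - z).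
Proof. by rewrite -(subrKA y); exact: nrmD. Qed.

Lemma lt_nrm t x : (`|x| < of_real k t) = (nrm x < t).
Proof. by rewrite -of_real_nrm ltr_of_real. Qed.

Lemma nbhs_nrmP x (A : set B) :
  nbhs x A <-> exists2 e : R, 0 < e & forall y, nrm (x - y) < e -> A y.
Proof.
split=> [/nbhs_normP[e /= e0 eA]|[e e0 eA]].
  have [t t0 te] := of_real_small e0.
  by exists t => // y xy; apply: eA => /=; rewrite (lt_le_trans _ te)// lt_nrm.
apply/nbhs_normP; exists (of_real k e); first by rewrite /= of_real_gt0.
by move=> y /=; rewrite lt_nrm; exact: eA.
Qed.

Lemma cvg_nrmP (s : nat -> B) x :
  s n @[n --> \oo] --> x <->
  forall e : R, 0 < e -> exists n0, forall n, (n0 <= n)%N -> nrm (x - s n) < e.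
Proof.
split=> [sx e e0|h].
  have /sx[n0 _ n0P] : nbhs x [set y | nrm (x - y) < e].
    by apply/nbhs_nrmP; exists e.
  by exists n0 => n /n0P.
move=> A /nbhs_nrmP[e e0 eA]; have [n0 n0P] := h e e0.
by exists n0 => // n /= /n0P; exact: eA.
Qed.

Lemma closure_nrmP C x :
  closure C x <-> forall e : R, 0 < e -> exists2 y, C y & nrm (x - y) < e.
Proof.
split=> [Cx e e0|h A /nbhs_nrmP[e e0 eA]].
  have /Cx[y [Cy yx]] : nbhs x [set y | nrm (x - y) < e].
    by apply/nbhs_nrmP; exists e.
  by exists y.
by have [y Cy xy] := h e e0; exists y; split => //; exact: eA.
Qed.

Definition real_convex C := forall x y t, C x -> C y -> 0 <= t <= 1 ->
  C (of_real k t *: x + of_real k (1 - t) *: y).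

Lemma of_real_scaleB t x y :
  of_real k t *: x + of_real k (1 - t) *: y = y + of_real k t *: (x - y).
Proof. by rewrite of_realB of_real1 scalerBl scale1r scalerBr addrCA addrA. Qed.

Definition real_additive (u : B -> R) := forall x y, u (x + y) = u x + u y.
Definition real_homogeneous (u : B -> R) :=
  forall t x, u (of_real k t *: x) = t * u x.

(** The unit ball of the real dual; the one-sided bound suffices because [u (- x) = - u x].
    Separation is done over [R] for both kinds of scalars, and [extend_scalars] returns to the
    functionals that define the weak topology. *)
Definition contraction (u : B -> R) :=
  [/\ real_additive u, real_homogeneous u & forall x, u x <= nrm x].

Section contraction_theory.
Variables (u : B -> R) (cu : contraction u).

Lemma contractionD x y : u (x + y) = u x + u y.
Proof. by case: cu. Qed.

Lemma contractionZ t x : u (of_real k t *: x) = t * u x.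
Proof. by case: cu. Qed.

Lemma contractionN x : u (- x) = - u x.
Proof. by rewrite -scaleN1r -of_real1 -of_realN contractionZ mulN1r. Qed.

Lemma contractionB x y : u (x - y) = u x - u y.
Proof. by rewrite contractionD contractionN. Qed.

Lemma contraction_le x : u x <= nrm x.
Proof. by case: cu. Qed.

Lemma contraction_abs x : `|u x| <= nrm x.
Proof.
by rewrite ler_norml contraction_le andbT lerNl -contractionN -nrmN contraction_le.
Qed.

End contraction_theory.

Definition sublinear (p : B -> R) :=
  (forall x y, p (x + y) <= p x + p y) /\
  (forall t x, 0 <= t -> p (of_real k t *: x) = t * p x).

Section minimal_sublinear.
Variables (q : B -> R) (sq : sublinear q).

Lemma sublinear0 : q 0 = 0.
Proof. by have := sq.2 0 0 (lexx _); rewrite of_real0 scale0r mul0r. Qed.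

Lemma sublinear_geN x : - q (- x) <= q x.
Proof. by have := sq.1 x (- x); rewrite subrr sublinear0; lra. Qed.

(* The slope of q at infinity in direction y: the sublinear minorant of q whose *)
(* equality with q expresses additivity of q at y.                              *)
Let tilt y x : R := inf [set q (x + of_real k t *: y) - t * q y | t in [set t | 0 <= t]].

Lemma tilt_lb y x t : 0 <= t -> - q (- x) <= q (x + of_real k t *: y) - t * q y.
Proof.
move=> t0; have := sq.1 (- x) (x + of_real k t *: y).
by rewrite addrA addNr add0r sq.2//; lra.
Qed.

Lemma tilt_le y x t : 0 <= t -> tilt y x <= q (x + of_real k t *: y) - t * q y.
Proof.
move=> t0; apply: ge_inf; last by exists t.
by exists (- q (- x)) => _ [s s0 <-]; exact: tilt_lb.
Qed.

Lemma tilt_ge y x m :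
  (forall t, 0 <= t -> m <= q (x + of_real k t *: y) - t * q y) -> m <= tilt y x.
Proof.
move=> h; apply: lb_le_inf; first by exists (q (x + of_real k 0 *: y) - 0 * q y), 0 => /=.
by move=> _ [s s0 <-]; exact: h.
Qed.

Lemma tilt_sublinear y : sublinear (tilt y).
Proof.
have tD x z : tilt y (x + z) <= tilt y x + tilt y z.
  rewrite -lerBlDr; apply: tilt_ge => t t0.
  rewrite lerBlDr [leRHS]addrC -lerBlDr; apply: tilt_ge => s s0.
  rewrite lerBlDr; apply: (le_trans (@tilt_le y _ (s + t) _)); first exact: addr_ge0.
  have -> : x + z + of_real k (s + t) *: y =
      (x + of_real k t *: y) + (z + of_real k s *: y).
    by rewrite of_realD scalerDl [of_real k s *: y + _]addrC addrACA.
  by have := sq.1 (x + of_real k t *: y) (z + of_real k s *: y); lra.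
have tZ t x : 0 < t -> t * tilt y x <= tilt y (of_real k t *: x).
  move=> t0; apply: tilt_ge => s s0.
  have := @tilt_le y x (t^-1 * s) (mulr_ge0 (ltW _) s0).
  rewrite invr_gt0 => /(_ t0) h.
  have -> : of_real k t *: x + of_real k s *: y =
            of_real k t *: (x + of_real k (t^-1 * s) *: y).
    by rewrite scalerDr scalerA -of_realM mulrA divff ?mul1r// gt_eqF.
  rewrite sq.2 ?(ltW t0)//.
  have -> : s * q y = t * ((t^-1 * s) * q y) by rewrite !mulrA divff ?mul1r// gt_eqF.
  by rewrite -mulrBr ler_pM2l.
split=> // t x; rewrite le_eqVlt => /predU1P[<-|t0].
  rewrite of_real0 scale0r mul0r; apply/eqP; rewrite eq_le; apply/andP; split.
    by have := @tilt_le y 0 0 (lexx _); rewrite of_real0 scale0r addr0 mul0r subr0 sublinear0.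
  by apply: tilt_ge => s s0; rewrite add0r sq.2// subrr.
apply/eqP; rewrite eq_le tZ// andbT.
have := tZ t^-1 (of_real k t *: x); rewrite invr_gt0 => /(_ t0).
rewrite scalerA -of_realM mulVf ?gt_eqF// of_real1 scale1r.
by rewrite ler_pdivrMl.
Qed.

(** A minimal [q] coincides with its minorant [tilt y] for every [y]. Reading this at [t = 1] gives
    [q x + q y <= q (x + y)], the missing half of additivity. *)
Lemma minimal_sublinear_additive :
  (forall q', sublinear q' -> (forall x, q' x <= q x) -> q' = q) ->
  real_additive q /\ real_homogeneous q.
Proof.
move=> mq.
have qD : real_additive q.
  move=> x y; apply/eqP; rewrite eq_le sq.1 /=.
  have tq : tilt y = q.
    apply: mq; first exact: tilt_sublinear.
    move=> z; have := @tilt_le y z 0 (lexx _).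
    by rewrite of_real0 scale0r addr0 mul0r subr0.
  have := @tilt_le y x 1 ler01; rewrite tq of_real1 scale1r mul1r; lra.
split=> // t x; have [t0|t0] := leP 0 t; first exact: sq.2.
have := sq.2 (- t) x; rewrite oppr_ge0 ltW// => /(_ isT).
have := qD (of_real k t *: x) (of_real k (- t) *: x).
rewrite -scalerDl -of_realD subrr of_real0 scale0r sublinear0; lra.
Qed.

End minimal_sublinear.

(** Zorn's lemma for the sublinear functionals below [p], in the reversed order, so that maximal
    elements are pointwise minimal functionals. The infimum of a nonempty chain is again sublinear
    because of two members of a chain the smaller one bounds both. *)
Lemma hahn_banach (p : B -> R) : sublinear p -> exists u : B -> R,
  [/\ real_additive u, real_homogeneous u & forall x, u x <= p x].
Proof.
move=> sp.
pose T := {q : B -> R | sublinear q /\ forall x, q x <= p x}.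
pose le (q r : T) : bool := `[< forall x, sval r x <= sval q x >].
have ltot (A : set T) : total_on A le -> exists t : T, forall s : T, A s -> le s t.
  move=> tA; have [[s0 As0]|A0] := pselect (A !=set0); last first.
    by exists (exist _ p (conj sp (fun x => lexx _))) => s As; case: A0; exists s.
  pose S x := [set sval s x | s in A].
  pose q x := inf (S x).
  have lbS x : lbound (S x) (- p (- x)).
    move=> _ [s As <-]; case: s As => r [sr rp] /= _.
    by have := sublinear_geN sr x; have := rp (- x); lra.
  have qle x (s : T) : A s -> q x <= sval s x.
    by move=> As; apply: ge_inf; [exists (- p (- x))|exists s].
  have qge x m : (forall s : T, A s -> m <= sval s x) -> m <= q x.
    move=> h; apply: lb_le_inf; first by exists (sval s0 x), s0.
    by move=> _ [s As <-]; exact: h.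
  have sq : sublinear q.
    split=> [x y|t x t0].
      rewrite -lerBlDr; apply: (qge) => s As.
      rewrite lerBlDr [leRHS]addrC -lerBlDr; apply: (qge) => s' As'; rewrite lerBlDr.
      have [/asboolP ss|/asboolP ss] := tA _ _ As As'.
        have [[h _] _] := svalP s'; have := h x y; have := qle (x + y) _ As'.
        by have := ss x; lra.
      have [[h _] _] := svalP s; have := h x y; have := qle (x + y) _ As.
      by have := ss y; lra.
    move: t0; rewrite le_eqVlt => /predU1P[<-|t0].
      rewrite of_real0 scale0r mul0r; apply/eqP; rewrite eq_le; apply/andP; split.
        by have [sr _] := svalP s0; rewrite -(sublinear0 sr) qle.
      by apply: (qge) => s As; have [sr _] := svalP s; rewrite (sublinear0 sr).
    apply/eqP; rewrite eq_le; apply/andP; split.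
      rewrite -ler_pdivrMl//; apply: (qge) => s As; rewrite ler_pdivrMl//.
      by have [[_ sZ] _] := svalP s; rewrite -(sZ _ _ (ltW t0)); exact: qle.
    apply: (qge) => s As; have [[_ sZ] _] := svalP s; rewrite (sZ _ _ (ltW t0)).
    by rewrite ler_pM2l// qle.
  have qp : sublinear q /\ forall x, q x <= p x.
    by split=> // x; apply: (le_trans (qle x _ As0)); have [_] := svalP s0.
  by exists (exist _ q qp) => s As; apply/asboolP => x /=; exact: qle.
have [|||[q [sq qp]] qmin] := @Zorn T le _ _ _ ltot.
- by move=> q; apply/asboolP.
- move=> q r s /asboolP qr /asboolP rs; apply/asboolP => x.
  exact: le_trans (rs x) (qr x).
- move=> [q hq] [r hr] /asboolP /= qr /asboolP /= rq.
  apply: eq_exist => /=; apply/funext => x.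
  by apply/eqP; rewrite eq_le qr rq.
have [|qD qZ] := @minimal_sublinear_additive q sq; last by exists q.
move=> r sr rq.
have rp : sublinear r /\ forall x, r x <= p x.
  by split=> // x; exact: le_trans (rq x) (qp x).
have : exist _ r rp = exist _ q (conj sq qp) :> T.
  by apply: qmin; apply/asboolP => x /=.
by case.
Qed.

(* The gauge x |-> inf {nrm (x + t c) - t delta : t >= 0, c in C} is at most      *)
(* - delta at - c, so a functional that it dominates is at least delta on C.      *)
Lemma separation C (delta : R) : C !=set0 -> real_convex C -> 0 <= delta ->
  (forall c, C c -> delta <= nrm c) ->
  exists2 u, contraction u & forall c, C c -> delta <= u c.
Proof.
move=> [c0 Cc0] cC d0 Cd.
pose S x := [set nrm (x + of_real k tc.1 *: tc.2) - tc.1 * delta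
            | tc in [set tc : R * B | 0 <= tc.1 /\ C tc.2]].
pose p x := inf (S x).
have lbS x : lbound (S x) (- nrm x).
  move=> _ [[t c] [/= t0 Cc] <-].
  have := nrmB_le (of_real k t *: c) (x + of_real k t *: c) 0.
  rewrite !subr0 opprD addrCA subrr addr0 nrmN nrmZ ger0_norm//.
  by have := ler_wpM2l t0 (Cd c Cc); lra.
have ple x t c : 0 <= t -> C c -> p x <= nrm (x + of_real k t *: c) - t * delta.
  move=> t0 Cc; apply: ge_inf; first by exists (- nrm x).
  by exists (t, c).
have pge x m : (forall t c, 0 <= t -> C c ->
    m <= nrm (x + of_real k t *: c) - t * delta) -> m <= p x.
  move=> h; apply: lb_le_inf.
    by exists (nrm (x + of_real k 0 *: c0) - 0 * delta), (0, c0).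
  by move=> _ [[t c] [/= t0 Cc] <-]; exact: h.
have p_nrm x : p x <= nrm x.
  by have := ple x 0 c0 (lexx _) Cc0; rewrite of_real0 scale0r addr0 mul0r subr0.
have p0 : p 0 = 0.
  apply/eqP; rewrite eq_le; apply/andP; split; first by rewrite -nrm0 p_nrm.
  apply: (pge) => t c t0 Cc; rewrite add0r nrmZ ger0_norm// subr_ge0.
  exact: ler_wpM2l (Cd c Cc).
have sp : sublinear p.
  split=> [x y|t x].
    rewrite -lerBlDr; apply: (pge) => t c t0 Cc.
    rewrite lerBlDr [leRHS]addrC -lerBlDr; apply: (pge) => s e s0 Ce; rewrite lerBlDr.
    have [st|st] := eqVneq (s + t) 0.
      have [s1 t1] : s = 0 /\ t = 0 by split; lra.
      rewrite s1 t1 of_real0 !scale0r !addr0 !mul0r !subr0.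
      by have := p_nrm (x + y); have := nrmD x y; lra.
    have st0 : 0 < s + t by rewrite lt_neqAle eq_sym st addr_ge0.
    (* Convexity of [C] enters here: [(s + t) f = t c + s e], so [f] with weight [s + t] competes in
       the infimum at [x + y]. *)
    pose f := of_real k (t / (s + t)) *: c + of_real k (1 - t / (s + t)) *: e.
    have Cf : C f.
      apply: cC => //; rewrite divr_ge0 ?(ltW st0)//=.
      by rewrite ler_pdivrMr// mul1r lerDr.
    have ef : of_real k (s + t) *: f = of_real k t *: c + of_real k s *: e.
      rewrite /f scalerDr !scalerA -!of_realM; congr (of_real k _ *: _ + of_real k _ *: _).
        by rewrite mulrCA divff// mulr1.
      by rewrite mulrBr mulr1 mulrCA divff// mulr1; lra.
    apply: (le_trans (ple (x + y) _ f (ltW st0) Cf)).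
    rewrite ef addrACA.
    by have := nrmD (x + of_real k t *: c) (y + of_real k s *: e); lra.
  have pZ s z : 0 < s -> s * p z <= p (of_real k s *: z).
    move=> s0; apply: (pge) => r c r0 Cc.
    have h := ple z (s^-1 * r) c (mulr_ge0 (ltW (etrans (invr_gt0 _) s0)) r0) Cc.
    have -> : of_real k s *: z + of_real k r *: c =
              of_real k s *: (z + of_real k (s^-1 * r) *: c).
      by rewrite scalerDr scalerA -of_realM mulrA divff ?mul1r// gt_eqF.
    rewrite nrmZ gtr0_norm//.
    have -> : r * delta = s * ((s^-1 * r) * delta).
      by rewrite !mulrA divff ?mul1r// gt_eqF.
    by rewrite -mulrBr ler_pM2l.
  rewrite le_eqVlt => /predU1P[<-|t0]; first by rewrite of_real0 scale0r mul0r.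
  apply/eqP; rewrite eq_le pZ// andbT.
  have := pZ t^-1 (of_real k t *: x); rewrite invr_gt0 => /(_ t0).
  by rewrite scalerA -of_realM mulVf ?gt_eqF// of_real1 scale1r ler_pdivrMl.
have [u [uD uZ up]] := hahn_banach sp.
have cu : contraction u by split=> // x; exact: le_trans (up x) (p_nrm x).
exists u => // c Cc.
have := le_trans (up (- c)) (ple (- c) 1 c ler01 Cc).
by rewrite of_real1 scale1r addNr nrm0 (contractionN cu) mul1r; lra.
Qed.

Lemma norming (x : B) : exists2 u, contraction u & u x = nrm x.
Proof.
have [|c e t -> ->|||u cu ux] := @separation [set x] (nrm x).
- by exists x.
- by rewrite of_real_scaleB subrr scaler0 addr0.
- exact: nrm_ge0.
- by move=> c ->.
by exists u => //; apply/eqP; rewrite eq_le contraction_le//= ux.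
Qed.

(** Outside [C], the point [x] would have a positive distance [e] to [C], and a contraction
    separating 0 from [C - x] would exceed [u x] by at least [e] on all of [C]. *)
Lemma mazur C x : C !=set0 -> closed C -> real_convex C ->
  (forall u, contraction u -> forall e : R, 0 < e -> exists2 c, C c & u c < u x + e) ->
  C x.
Proof.
move=> [c0 Cc0] clC cC h; apply: contrapT => nCx.
have [e [e0 eC]] : exists e : R, 0 < e /\ forall c, C c -> e <= nrm (c - x).
  apply: contrapT => hn; apply: nCx; apply: clC; apply/closure_nrmP => e e0.
  apply: contrapT => he; apply: hn; exists e; split=> // c Cc.
  by rewrite leNgt; apply/negP => ce; apply: he; exists c => //; rewrite nrm_distC.
have [|y z t [c Cc <-] [c' Cc' <-] t01||_ [c Cc <-]|u cu ux] :=
    @separation [set c - x | c in C] e.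
- by exists (c0 - x), c0.
- exists (of_real k t *: c + of_real k (1 - t) *: c'); first exact: cC.
  rewrite !of_real_scaleB addrAC; congr (_ + _ *: _).
  by rewrite opprB addrA subrK.
- exact: ltW.
- exact: eC.
have [c Cc] := h u cu e e0; have := ux (c - x); rewrite contractionB//.
by move=> /(_ (ex_intro2 _ _ c Cc erefl)); lra.
Qed.

End real_norm.

(** * The weak topology *)

Section weak_topology_theory.
Context (R : realType) (k : scalar_kind).
Local Notation K := (scalar_field R k).

Lemma continuous_real_part : continuous (@real_part R k : K -> R).
Proof.
move=> z A /nbhs_normP[e /= e0 eA].
apply/(@nbhs_normP _ (K^o : normedModType K)).
exists (of_real k e); first by rewrite /= of_real_gt0.
move=> w /= zw; apply: eA => /=.
have rB (a b : K) : real_part a - real_part b <= real_part `|a - b|.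
  have := real_part_le_norm (a - b); rewrite real_partD.
  by rewrite -[in X in _ + X]scaleN1r -(of_real1 R k) -of_realN real_partM mulN1r.
rewrite ltr_norml ltrNl opprB; apply/andP; split.
  by rewrite (le_lt_trans (rB _ _))// -(ltr_of_real k) real_part_norm distrC.
by rewrite (le_lt_trans (rB _ _))// -(ltr_of_real k) real_part_norm.
Qed.

Lemma linear_continuous_nrm (B : normedModType K) (f : {linear B -> K^o}) :
  (forall x, `|f x| <= of_real k (2 * nrm x)) -> continuous (f : B -> K^o).
Proof.
move=> fb x; apply/cvgrPdist_lt => e /of_real_small[t t0 te].
have t20 : 0 < t / 2 by rewrite divr_gt0.
have : nbhs x [set y | nrm (x - y) < t / 2] by apply/nbhs_nrmP; exists (t / 2).
apply: filterS => y /= xy; rewrite -linearB (lt_le_trans _ te)//.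
by rewrite (le_lt_trans (fb _))// ltr_of_real; lra.
Qed.

Lemma weak_nbhs (B : normedModType K) (f : continuous_functional B)
    (p : weak_topology B) (e : R) : 0 < e ->
  nbhs p [set y : weak_topology B | `|sval f p - sval f y| < of_real k e].
Proof.
move=> e0.
have h : nbhs p --> (p : weak_topology B) by [].
have {}h := (cvg_sup _ _ _).1 h f.
apply: (h (nbhs_filter p) [set y | `|sval f p - sval f y| < of_real k e]).
have ic := @initial_continuous B K^o (sval f) p.
apply: (ic [set z | `|sval f p - z| < of_real k e]).
by apply/nbhs_normP; exists (of_real k e); rewrite //= of_real_gt0.
Qed.

End weak_topology_theory.

(** Over the complex numbers the functional is [u x - i u (i x)]. Its modulus is at most
    [|u x| + |u (i x)|], whence the constant 2 in [linear_continuous_nrm]. *)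
Lemma extend_scalars (R : realType) (k : scalar_kind)
    (B : normedModType (scalar_field R k)) (u : B -> R) : contraction u ->
  exists f : continuous_functional B, forall x, real_part (sval f x) = u x.
Proof.
case: k B u => [|] B u cu.
  have lu : linear (u : B -> R^o).
    by move=> a x y; rewrite (contractionD cu) (contractionZ cu a x : u (a *: x) = _).
  pose f : {linear B -> R^o} := HB.pack_for {linear B -> R^o} (u : B -> R^o)
    (GRing.isLinear.Build R B R^o *:%R (u : B -> R^o) lu).
  have fc : continuous (f : B -> R^o).
    apply: (@linear_continuous_nrm R RealScalars) => x /=.
    have : `|u x| <= 2 * nrm x.
      by have := contraction_abs cu x; have := nrm_ge0 x; lra.
    exact.
  by exists (exist _ f fc).
pose ii : R[i] := 'i%C.
have ii2 : ii * ii = -1 by apply/eqP; rewrite eq_complex /=; apply/andP; split; apply/eqP; ring.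
pose F x : R[i]^o := (u x +i* (- u (ii *: x)))%C.
have luR a x y : u (a%:C%C *: x + y) = a * u x + u y.
  by rewrite (contractionD cu) (contractionZ cu a x : u (_ *: x) = _).
have sE (a : R[i]) (x : B) :
    a *: x = (complex.Re a)%:C%C *: x + (complex.Im a)%:C%C *: (ii *: x).
  rewrite scalerA -scalerDl; congr (_ *: _); case: a => p q /=.
  by apply/eqP; rewrite eq_complex /=; apply/andP; split; apply/eqP; ring.
have lF : linear F.
  move=> a x y; rewrite /F.
  have e1 : u (a *: x + y) =
      complex.Re a * u x + complex.Im a * u (ii *: x) + u y.
    by rewrite sE -addrA luR luR addrA.
  have e2 : u (ii *: (a *: x + y)) =
      complex.Re a * u (ii *: x) - complex.Im a * u x + u (ii *: y).
    rewrite scalerDr scalerA mulrC -scalerA sE -addrA luR luR addrA.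
    by rewrite scalerA ii2 scaleN1r (contractionN cu) mulrN.
  rewrite e1 e2; case: a {e1 e2} => p q /=; apply/eqP.
  by rewrite eq_complex /=; apply/andP; split; apply/eqP; ring.
pose f : {linear B -> R[i]^o} := HB.pack_for {linear B -> R[i]^o} F
    (GRing.isLinear.Build R[i] B R[i]^o *:%R F lF).
have fc : continuous (f : B -> R[i]^o).
  apply: (@linear_continuous_nrm R ComplexScalars) => x /=.
  have nF (p q : R) : `|p| + `|q| <= 2 * nrm x -> `|(p +i* q)%C| <= (2 * nrm x)%:C%C.
    move=> pq; rewrite normc_def /= lecR; apply: le_trans pq.
    rewrite -(ler_pXn2r (n := 2))// ?nnegrE ?sqrtr_ge0 ?addr_ge0//.
    rewrite sqr_sqrtr ?addr_ge0 ?sqr_ge0// -(real_normK (num_real p)) -(real_normK (num_real q)).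
    by have := normr_ge0 p; have := normr_ge0 q; nra.
  apply: nF; rewrite normrN.
  have := contraction_abs cu x; have := contraction_abs cu (ii *: x).
  have -> : nrm (ii *: x) = nrm x.
    rewrite /nrm normrZ.
    have -> : `|ii| = 1 by rewrite normc_def /= expr0n expr1n add0r sqrtr1.
    by rewrite mul1r.
  lra.
by exists (exist _ f fc).
Qed.

Section weakly_compact_theory.
Context (R : realType) (k : scalar_kind) (B : normedModType (scalar_field R k)).
Implicit Types (V C : set B) (u : B -> R).

Lemma weakly_compact_cluster V (x_ : nat -> B) :
  weakly_compact V -> (forall n, V (x_ n)) ->
  exists2 x, V x & forall u, contraction u -> forall e, 0 < e ->
    forall n0, exists2 m, (n0 <= m)%N & `|u (x_ m) - u x| < e.
Proof.
move=> cV Vx.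
pose F : set_system (weak_topology B) := x_ @ \oo.
have FF : ProperFilter F by apply: fmap_proper_filter.
have FV : F V by exists 0%N => // n _; exact: Vx.
have [x [Vx' cx]] := cV F FF FV.
exists x => // u cu e e0 n0; have [f fu] := extend_scalars cu.
have Fn0 : F [set x_ m | m in [set m | (n0 <= m)%N]].
  by exists n0 => // m /= nm; exists m.
have [_ [[m nm <-] xm]] := cx _ _ Fn0 (weak_nbhs f x e0).
exists m => //; rewrite -!fu distrC -(ltr_of_real k) (le_lt_trans _ xm)//.
rewrite -norm_of_real -[leRHS]real_part_norm norm_of_real ler_of_real.
have rB (a b : scalar_field R k) : real_part a - real_part b <= real_part `|a - b|.
  have := real_part_le_norm (a - b); rewrite real_partD.
  by rewrite -[in X in _ + X]scaleN1r -(of_real1 R k) -of_realN real_partM mulN1r.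
by rewrite ler_norml lerNl opprB rB andbT distrC rB.
Qed.

(* The closed convex members of an ultrafilter determine its weak limit, since a *)
(* weak neighbourhood is cut out by finitely many half-spaces.                   *)
Lemma weakly_compact_ultra V : closed V -> real_convex V ->
  (forall F : set_system B, UltraFilter F -> F V -> exists2 x, V x &
    forall C, closed C -> real_convex C -> C `<=` V -> F C -> C x) ->
  weakly_compact V.
Proof.
move=> clV cV h; rewrite /weakly_compact compact_ultra => F FU FV.
have [x Vx xC] := h F FU FV; exists x; split=> //.
have FF : Filter F by exact: filter_filter.
apply/cvg_sup => -[f fc] A [_ [[U oU <-] Ux UA]].
apply: (filterS UA).
have /nbhs_normP[e0 /of_real_small[t t0 te] eU] : nbhs (f x : _^o) U.
  exact: open_nbhs_nbhs.
(* Each [H c] is closed, convex and misses [x], so it is not in [F] and its complement is. By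
   [directionsP], the points of [V] outside [H c] for all [c] in [directions] satisfy
   [|f y - f x| < e0]. *)
pose H c : set B := V `&` [set y | t / 2 <= real_part (c * (f y - f x))].
have nFH c : ~ F (H c).
  move=> FH; have : H c x.
    apply: (xC _ _ _ _ FH); last by move=> y [].
      apply: closedI => //.
      rewrite (_ : mkset _ = (fun y => real_part (c * (f y - f x))) @^-1` [set s | t / 2 <= s])//.
      apply: closed_comp; last exact: closed_ge.
      move=> y _.
      apply: (@continuous_comp B (scalar_field R k) R (fun y => c * (f y - f x))).
        apply: (@cvgM (scalar_field R k)); first exact: cvg_cst.
        by apply: (@cvgB (scalar_field R k) (scalar_field R k)^o); [exact: fc|exact: cvg_cst].
      exact: continuous_real_part.
    move=> y z s [Vy yt] [Vz zt] s01; split; first exact: cV.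
    rewrite /= of_real_scaleB linearD linearZ linearB /=.
    rewrite [X in real_part X](_ : _ = of_real k s * (c * (f y - f x)) +
      of_real k (1 - s) * (c * (f z - f x))).
      rewrite real_partD !real_partM.
      have /andP[s0 s1] := s01; move: yt zt => /= yt zt.
      have := ler_wpM2l s0 yt; have s10 : 0 <= 1 - s by lra.
      by have := ler_wpM2l s10 zt; lra.
    rewrite of_realB of_real1 /GRing.scale /=; ring.
  by move=> [_ /=]; rewrite subrr mulr0 -(of_real0 R k) real_part_of_real; lra.
have FH (s : seq (scalar_field R k)) : F [set y | forall c, c \in s -> ~ H c y].
  elim: s => [|c s IHs]; first by apply: filterS filterT.
  have [/nFH//|Fc] := in_ultra_setVsetC (H c) FU.
  apply: filterS2 IHs Fc => y ys yc c'.
  by rewrite inE => /orP[/eqP ->//|]; exact: ys.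
apply: filterS2 (FH (directions R k)) FV => y Hy Vy; apply: eU => /=.
have e00 : 0 < e0 by rewrite (lt_le_trans _ te)// of_real_gt0.
rewrite real_ltNge ?normr_real ?gtr0_real//; apply/negP => ef.
have := le_trans te ef; rewrite distrC => /directionsP[c cd ct].
exact: (Hy c cd (conj Vy ct)).
Qed.

End weakly_compact_theory.

(** * Random elements and the convergence in probability *)

Section bounded_random_variables.
Context (R : realType) d (Omega : measurableType d) (P : probability Omega R).
Implicit Types (f g : Omega -> R) (A C : set Omega).

Definition bounded_rv f := measurable_fun setT f /\ exists M, forall w, `|f w| <= M.

Lemma bounded_rv_integrable A f : measurable A -> bounded_rv f ->
  P.-integrable A (EFin \o f).
Proof.
move=> mA [mf [M fM]]; apply: measurable_bounded_integrable => //.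
- by rewrite (le_lt_trans (probability_le1 P mA))// ltry.
- exact: measurable_funS mf.
- exists M; split; first exact: num_real.
  by move=> N MN w _; exact: le_trans (fM w) (ltW MN).
Qed.

Lemma bounded_rvD f g : bounded_rv f -> bounded_rv g -> bounded_rv (fun w => f w + g w).
Proof.
move=> [mf [M fM]] [mg [N gN]]; split; first exact: measurable_funD.
by exists (M + N) => w; rewrite (le_trans (ler_normD _ _))// lerD.
Qed.

Lemma bounded_rvZ c f : bounded_rv f -> bounded_rv (fun w => c * f w).
Proof.
move=> [mf [M fM]]; split; first exact: measurable_funM.
by exists (`|c| * M) => w; rewrite normrM ler_wpM2l.
Qed.

Lemma bounded_rv_sqr f : bounded_rv f -> bounded_rv (fun w => f w ^+ 2).
Proof.
move=> [mf [M fM]]; split; first exact: measurable_funX.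
exists (M ^+ 2) => w; rewrite normrX lerXn2r// nnegrE//.
exact: (le_trans _ (fM w)).
Qed.

Lemma Rintegral_le A f g : measurable A -> bounded_rv f -> bounded_rv g ->
  (forall w, A w -> f w <= g w) ->
  \int[P]_(w in A) f w <= \int[P]_(w in A) g w.
Proof. by move=> mA bf bg fg; apply: le_Rintegral => //; exact: bounded_rv_integrable. Qed.

Lemma Rintegral_cat A C f : measurable A -> measurable C -> bounded_rv f ->
  A `&` C = set0 ->
  \int[P]_(w in A `|` C) f w = \int[P]_(w in A) f w + \int[P]_(w in C) f w.
Proof.
move=> mA mC bf AC; apply: Rintegral_setU => //.
  by apply: bounded_rv_integrable => //; exact: measurableU.
exact/disj_set2P.
Qed.

Lemma Rintegral_subset A C f : measurable A -> measurable C -> bounded_rv f ->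
  (forall w, 0 <= f w) -> A `<=` C ->
  \int[P]_(w in A) f w <= \int[P]_(w in C) f w.
Proof.
move=> mA mC bf f0 AC.
rewrite -(setDUK AC) Rintegral_cat//; [|exact: measurableD|exact: setDIK].
by rewrite lerDl Rintegral_ge0.
Qed.

Lemma Rintegral_le_cst A f c : measurable A -> bounded_rv f ->
  (forall w, A w -> f w <= c) -> \int[P]_(w in A) f w <= c * fine (P A).
Proof.
move=> mA bf fc; rewrite -Rintegral_cst//; apply: Rintegral_le => //.
by split; [exact: measurable_cst|exists `|c|].
Qed.

Lemma fine_probability_le A C : measurable A -> measurable C -> A `<=` C ->
  fine (P A) <= fine (P C).
Proof.
move=> mA mC AC; apply: fine_le; [exact: fin_num_measure..|].
by apply: le_measure; rewrite ?inE.
Qed.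

Lemma fine_probability_le1 A : measurable A -> fine (P A) <= 1.
Proof.
by move=> mA; rewrite -lee_fin fineK ?fin_num_measure// probability_le1.
Qed.

Lemma fine_probability_setC A : measurable A -> fine (P (~` A)) = 1 - fine (P A).
Proof.
move=> mA; rewrite probability_setC// fineB//.
exact: fin_num_measure.
Qed.

Lemma Rintegral_markov f e : bounded_rv f -> (forall w, 0 <= f w) ->
  measurable [set w | e <= f w] /\
  e * fine (P [set w | e <= f w]) <= \int[P]_w f w.
Proof.
move=> bf f0; have mA : measurable [set w | e <= f w].
  have := bf.1 measurableT _ (measurable_itv `[e, +oo[); rewrite setTI.
  by congr measurable; apply/seteqP; split=> w /=; rewrite in_itv/= andbT.
split=> //; rewrite -Rintegral_cst//.
have be : bounded_rv (fun=> e) by split; [exact: measurable_cst|exists `|e|].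
apply: le_trans (Rintegral_subset mA measurableT bf f0 _) => //.
exact: Rintegral_le.
Qed.

End bounded_random_variables.

Section random_elements_in_B.
Context (R : realType) (k : scalar_kind) d (Omega : measurableType d).
Context (B : normedModType (scalar_field R k)).
Local Notation strong_elt := (strong_elt Omega B).
Implicit Types (X Y Z : strong_elt) (A : set Omega).

Lemma measurable_random X (g : B -> R) : continuous g ->
  measurable_fun setT (g \o X).
Proof.
move=> /continuousP cg.
apply: (measurability _ (RGenOpens.measurableE R)) => _ [_ [a [b ->] <-]].
rewrite setTI.
exact: (strong_random_elementW (strong_eltP X) (cg _ (interval_open _ _))).
Qed.

Lemma continuous_contraction (u : B -> R) : contraction u -> continuous u.
Proof.
move=> cu x A /nbhs_normP[e /= e0 eA].
apply/nbhs_nrmP; exists e => // y xy; apply: eA => /=.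
by rewrite -(contractionB cu) (le_lt_trans (contraction_abs cu _)).
Qed.

Lemma continuous_nrm : continuous (@nrm R k B).
Proof.
move=> x A /nbhs_normP[e /= e0 eA].
apply/nbhs_nrmP; exists e => // y xy; apply: eA => /=.
rewrite ltr_norml; have := nrmB_le x y 0; have := nrmB_le y x 0.
by rewrite !subr0 (nrm_distC y x); lra.
Qed.

(* The (epsilon, lambda)-topology is induced by the integral of this distance. *)
Definition truncated X Y : Omega -> R := fun w => Num.min 1 (nrm (X w - Y w)).

Lemma truncated_ge0 X Y w : 0 <= truncated X Y w.
Proof. by rewrite le_min ler01 nrm_ge0. Qed.

Lemma truncated_triangle X Y Z w :
  truncated X Z w <= truncated X Y w + truncated Y Z w.
Proof.
rewrite /truncated ge_min.
have := nrmB_le (X w) (Y w) (Z w); have := nrm_ge0 (X w - Y w).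
have := nrm_ge0 (Y w - Z w).
case: (leP 1 (nrm (X w - Y w))); case: (leP 1 (nrm (Y w - Z w))) => *; apply/orP; lra.
Qed.

Lemma truncatedC X Y : truncated X Y = truncated Y X.
Proof. by apply/funext => w; rewrite /truncated nrm_distC. Qed.

Lemma bounded_truncated X Y : bounded_rv (truncated X Y).
Proof.
split; last first.
  by exists 1 => w; rewrite ger0_norm ?truncated_ge0// ge_min lexx.
apply: measurable_minr; first exact: measurable_cst.
exact: (measurable_random (X - Y) continuous_nrm).
Qed.

Definition mix (xi : {mfun Omega >-> R}) X Y : strong_elt :=
  strong_scale xi X + strong_scale (1 - xi) Y.

Lemma mixE xi X Y w :
  mix xi X Y w = of_real k (xi w) *: X w + of_real k (1 - xi w) *: Y w.
Proof. by []. Qed.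

(** Written as a convex combination with an indicator as coefficient, so that L0-convex sets are
    stable under pasting. *)
Definition glue A (mA : measurable A) X Y : strong_elt := mix (mindic R mA) X Y.

Lemma glue_in A (mA : measurable A) X Y w : A w -> glue mA X Y w = X w.
Proof.
move=> Aw; have e : (mindic R mA : {mfun Omega >-> R}) w = 1.
  by rewrite /= mindicE mem_set.
rewrite mixE e.
by rewrite subrr of_real1 of_real0 scale1r scale0r addr0.
Qed.

Lemma glue_out A (mA : measurable A) X Y w : ~ A w -> glue mA X Y w = Y w.
Proof.
move=> Aw; have e : (mindic R mA : {mfun Omega >-> R}) w = 0.
  by rewrite /= mindicE memNset.
rewrite mixE e.
by rewrite subr0 of_real1 of_real0 scale1r scale0r add0r.
Qed.

Lemma strong_random_element_cst (v : B) :
  strong_random_element (fun _ : Omega => v).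
Proof.
exists (fun _ _ => v); split=> [n|w]; last exact: cvg_cst.
split=> [G _|].
  have [Gv|Gv] := pselect (G v).
    by rewrite (_ : _ @^-1` G = setT)//; apply/seteqP; split.
  by rewrite (_ : _ @^-1` G = set0)//; apply/seteqP; split.
by apply: (sub_finite_set _ (finite_set1 v)) => _ [w _ <-].
Qed.

Definition cst_elt (v : B) : strong_elt :=
  StrongElt (asboolT (strong_random_element_cst v)).

End random_elements_in_B.
Arguments cst_elt {R k d} Omega {B} v.

Section L0_interface.
Context (R : realType) (k : scalar_kind) d (Omega : measurableType d).
Context (P : probability Omega R) (B : normedModType (scalar_field R k)).
Local Notation strong_elt := (strong_elt Omega B).
Local Notation L0 := (L0 P B).
Local Notation "\pi0 X" := (\pi_L0 X : L0) (at level 10).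
Implicit Types (X Y Z : strong_elt) (G : set L0) (V : set B).

Lemma measurable_nrm_lt Z (e : R) : measurable [set w | nrm (Z w) < e].
Proof.
have := measurable_small Z e; congr measurable.
by apply/seteqP; split=> w /=; rewrite lt_nrm.
Qed.

Lemma L0_nbhs0_pi (e l : R) Z :
  L0_nbhs0 e l (\pi0 Z) <-> 1 - l < fine (P [set w | nrm (Z w) < e]).
Proof.
rewrite /L0_nbhs0 /=.
have -> : P [set w | `|repr (\pi0 Z) w| < of_real k e] = P [set w | nrm (Z w) < e].
  apply/eqP; rewrite eq_le; apply/andP; split; apply: le_probability_ae;
    try exact: measurable_small; try exact: measurable_nrm_lt;
    have := repr_L0 P Z; apply: filterS => w /(_ I) e1 /=; by rewrite e1 lt_nrm.
have mZ := measurable_nrm_lt Z e.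
by rewrite -[in X in X <-> _](fineK (fin_num_measure P _ mZ)) lte_fin.
Qed.

Lemma pi_L0_sub X Y : \pi0 X - \pi0 Y = \pi0 (X - Y).
Proof. by rewrite (pi_L0_add P X (- Y)) (pi_L0_opp P Y). Qed.

Lemma mem_closed_L0 G X : closed G ->
  (forall e : R, 0 < e ->
    exists2 Y, G (\pi0 Y) & \int[P]_w truncated X Y w < e) ->
  G (\pi0 X).
Proof.
move=> clG h; apply: clG => A [[e l] [/= e0 /andP[l0 l1]] elA].
(* As [c <= 1], truncation changes nothing below [c]; the bound [c * l] on the integral then leaves
   probability less than [l] by Markov's inequality. *)
pose c := Num.min 1 e.
have c0 : 0 < c by rewrite lt_min ltr01.
have [Y GY XY] := h (c * l) (mulr_gt0 c0 l0).
exists (\pi0 Y); split=> //; apply: elA => /=; rewrite pi_L0_sub.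
apply/L0_nbhs0_pi.
have [mA Ac] := Rintegral_markov P c (bounded_truncated X Y) (truncated_ge0 X Y).
have {}Ac : fine (P [set w | c <= truncated X Y w]) < l.
  by rewrite -(ltr_pM2l c0); exact: le_lt_trans XY.
have : ~` [set w | c <= truncated X Y w] `<=` [set w | nrm ((Y - X) w) < e].
  move=> w /= /negP; rewrite -ltNge /truncated lt_min -/c => h1.
  rewrite (nrm_distC (Y w) (X w)).
  move: h1; rewrite /c /Num.min; case: ifP => [? ?|/negbT]; first by lra.
  by rewrite -leNgt => ? ?; lra.
move=> /(fine_probability_le P (measurableC mA) (measurable_nrm_lt _ _)).
by rewrite fine_probability_setC//; lra.
Qed.

Lemma closure_L0 G X (e : R) : closure G (\pi0 X) -> 0 < e ->
  exists2 Y, G (\pi0 Y) & fine (P [set w | e <= nrm (X w - Y w)]) <= e.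
Proof.
move=> GX e0; pose l := Num.min e 2^-1.
have l0 : 0 < l by rewrite lt_min e0 invr_gt0 ltr0n.
have l1 : l < 1 by rewrite gt_min; apply/orP; right; lra.
have [y [Gy yX]] := GX [set y | L0_nbhs0 e l (y - \pi0 X)]
  (ex_intro2 _ _ (e, l) (conj e0 (introT andP (conj l0 l1))) (@subset_refl _ _)).
pose Y := repr y; have Yy : \pi0 Y = y by rewrite reprK.
exists Y; first by rewrite Yy.
move: yX; rewrite /= -Yy pi_L0_sub => /L0_nbhs0_pi.
have mA := measurable_nrm_lt (Y - X) e.
have -> : [set w | e <= nrm (X w - Y w)] = ~` [set w | nrm ((Y - X) w) < e].
  apply/seteqP; split=> w /=; rewrite nrm_distC; first by move=> h; apply/negP; rewrite -leNgt.
  by move/negP; rewrite -leNgt.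
rewrite fine_probability_setC// => h.
have : l <= e by rewrite ge_min lexx.
by move: h; set q := fine _; lra.
Qed.

Lemma L0_convex_mix G X Y (xi : {mfun Omega >-> R}) : L0_convex G ->
  (forall w, 0 <= xi w <= 1) -> G (\pi0 X) -> G (\pi0 Y) -> G (\pi0 (mix xi X Y)).
Proof.
move=> cG xi01 GX GY.
rewrite (_ : \pi0 (mix xi X Y) =
    L0_scale (\pi_({mfun_ P, Omega >-> R}) xi) (\pi0 X) +
    L0_scale (\pi_({mfun_ P, Omega >-> R}) (1 - xi)) (\pi0 Y)); last first.
  by rewrite (pi_L0_add P (strong_scale xi X)) !pi_L0_scale.
have ae_repr (f : {mfun Omega >-> R}) :
    repr (\pi_({mfun_ P, Omega >-> R}) f) = f %[ae P].
  by have /eqquotP/asboolP := reprK (\pi_({mfun_ P, Omega >-> R}) f).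
have h1 := ae_repr xi; have h2 := ae_repr (1 - xi).
apply: cG => //.
- by apply: filterS h1 => w /(_ I) e1; rewrite /aqEqMfun_to_fun e1; have /andP[] := xi01 w.
- apply: filterS h2 => w /(_ I) e1; rewrite /aqEqMfun_to_fun e1 /=; have /andP[_] := xi01 w.
  by rewrite subr_ge0.
- by apply: filterS2 h1 h2 => w /(_ I) e1 /(_ I) e2; rewrite /aqEqMfun_to_fun e1 e2 /= subrKC.
Qed.

Lemma L0_valuedP V X : V !=set0 ->
  L0_valued P V (\pi0 X) <-> {ae P, forall w, V (X w)}.
Proof.
move=> [v Vv]; split=> [[Y VY /eq_L0P YX]|[N [mN N0 VN]]].
  by apply: filterS YX => w /(_ I) <-.
pose Y : strong_elt := cst_elt Omega v.
exists (glue mN Y X).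
  move=> w; have [Nw|Nw] := pselect (N w); first by rewrite glue_in.
  by rewrite glue_out//; apply: contrapT => h; apply: Nw; exact: VN.
apply/eq_L0P; exists N; split=> // w h; apply: contrapT => Nw; apply: h => _.
by rewrite glue_out.
Qed.

(** Approximants with values in [V] show, for each [n], that [X] almost surely lies within
    [n.+1%:R^-1] of [V]. A countable union of null sets and the closedness of [V] do the rest. *)
Lemma closed_L0_valued V : V !=set0 -> closed V -> closed (L0_valued P V).
Proof.
move=> V0 clV x; rewrite -[x]reprK; set X := repr x => cX.
apply/(L0_valuedP _ V0).
pose U n := \bigcup_(y in V) [set z | nrm (z - y) < n.+1%:R^-1].
have oU n : open (U n).
  apply: bigcup_open => y Vy; rewrite openE => z /= zy.
  apply/nbhs_nrmP; exists (n.+1%:R^-1 - nrm (z - y)); first by rewrite subr_gt0.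
  move=> t zt /=; rewrite (le_lt_trans (nrmB_le t z y))// (nrm_distC t z).
  by rewrite -ltrBrDr.
pose N := ~` (X @^-1` V).
have mV (A : set B) : open A -> measurable (X @^-1` A).
  exact: (strong_random_elementW (strong_eltP X)).
have mN : measurable N.
  rewrite /N preimage_setC; apply: mV; exact: closed_openC.
have mUn n : measurable (X @^-1` (~` U n)).
  by rewrite -preimage_setC; apply: measurableC; exact: mV.
have U0 n : P (X @^-1` (~` U n)) = 0%E.
  have mF := fin_num_measure P _ (mUn n).
  rewrite -(fineK mF); congr _%:E; apply/eqP; rewrite eq_le fine_ge0 ?andbT//.
  apply/ler_addgt0Pr => e e0; rewrite add0r.
  pose c := Num.min e n.+1%:R^-1.
  have c0 : 0 < c by rewrite lt_min e0 invr_gt0 ltr0n.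
  have [Y /(L0_valuedP _ V0)VY XY] := closure_L0 cX c0.
  have ce : c <= e by rewrite ge_min lexx.
  apply: le_trans (le_trans XY ce).
  have m2 : measurable [set w | c <= nrm (X w - Y w)].
    have := measurableC (measurable_nrm_lt (X - Y) c); congr measurable.
    by apply/seteqP; split=> w /=; rewrite leNgt => /negP.
  apply: fine_le; [exact: mF|exact: fin_num_measure|].
  apply: le_probability_ae => //.
  apply: filterS VY => w VYw /= Uw; rewrite leNgt; apply/negP => h; apply: Uw.
  exists (Y w) => //=; rewrite (lt_le_trans h)// ge_min lexx orbT//.
have : P.-negligible (\bigcup_n X @^-1` (~` U n)).
  apply: negligible_bigcup => n; exists (X @^-1` (~` U n)); split=> //.
  exact: U0.
apply: negligibleS => w /= nV; apply: contrapT => h; apply: nV; apply: clV.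
apply/closure_nrmP => e e0.
have [m] := ltr_add_invr e0; rewrite add0r => me.
apply: contrapT => he; apply: h; exists m => // -[y Vy /= yX].
by apply: he; exists y => //; rewrite (lt_trans yX).
Qed.

Lemma L0_convex_L0_valued V : V !=set0 -> real_convex V -> L0_convex (L0_valued P V).
Proof.
move=> V0 cV x y xi eta; rewrite -[x]reprK -[y]reprK.
move=> /(L0_valuedP _ V0) Vx /(L0_valuedP _ V0) Vy xi0 eta0 xe.
rewrite (_ : _ + _ = \pi0 (strong_scale (repr xi) (repr x) + strong_scale (repr eta) (repr y))).
  apply/(L0_valuedP _ V0).
  have Vxy : {ae P, forall w, V (repr x w) /\ V (repr y w)}.
    by move: Vy; apply: filterS2 Vx => w.
  have xe01 : {ae P, forall w, 0 <= xi w /\ 0 <= eta w /\ xi w + eta w = 1}.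
    by move: xi0 eta0 xe; apply: filterS3 => w.
  move: Vxy xe01; apply: filterS2 => w [Vxw Vyw] [x0 [e0 xe1]].
  rewrite strong_addE !strong_scaleE.
  have -> : repr eta w = 1 - repr xi w by rewrite -xe1 addrC addKr.
  by apply: cV => //; apply/andP; split=> //; rewrite -xe1 lerDl.
by rewrite (pi_L0_add P (strong_scale _ _)) !pi_L0_scale !reprK.
Qed.

End L0_interface.

(** * Essential values *)

Section separable_range.
Context (R : realType) (k : scalar_kind) d (Omega : measurableType d).
Context (P : probability Omega R) (B : normedModType (scalar_field R k)).
Local Notation strong_elt := (strong_elt Omega B).
Implicit Types (X : strong_elt).

Lemma separable_range X : exists e : nat -> B, forall w, closure (range e) (X w).
Proof.
have [s [ss sX]] := strong_eltP X.
have : countable (\bigcup_n range (s n)).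
  by apply: bigcup_countable => // n _; apply: finite_set_countable; have [] := ss n.
move=> /countable_injP[f finj].
pose e j := xget (0 : B) [set b | (\bigcup_n range (s n)) b /\ f b = j].
exists e => w; apply/closure_nrmP => r r0.
have /cvg_nrmP/(_ r r0)[n0 n0P] := sX w.
exists (s n0 w); last exact: n0P.
have As : (\bigcup_n range (s n)) (s n0 w) by exists n0 => //; exists w.
exists (f (s n0 w)) => //; rewrite /e; case: xgetP => [b _ [Ab fb]|/(_ (s n0 w))].
  by apply: finj => //; rewrite inE.
by case.
Qed.

Lemma essential_value X : exists b : B, forall r : R, 0 < r ->
  ~ P.-negligible [set w | nrm (X w - b) < r].
Proof.
apply: contrapT => /forallNP h.
have {}h b : exists2 r : R, 0 < r & P.-negligible [set w | nrm (X w - b) < r].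
  have /existsNP[r /not_implyP[r0 /contrapT rN]] := h b; by exists r.
have [e eX] := separable_range X.
(* Now every point has a null ball around it. Balls around the dense points [e j] inside such a ball
   are null as well, and countably many of their preimages cover [Omega], which has probability
   one. *)
pose A j m := [set w | nrm (X w - e j) < m.+1%:R^-1].
pose N j m : set Omega := if `[< P.-negligible (A j m) >] then A j m else set0.
have : P.-negligible (\bigcup_j \bigcup_m N j m).
  apply: negligible_bigcup => j; apply: negligible_bigcup => m.
  by rewrite /N; case: asboolP => // _; exact: negligible_set0.
have -> : \bigcup_j \bigcup_m N j m = setT.
  apply/seteqP; split=> // w _; have [r r0 rN] := h (X w).
  have [m] := @ltr_add_invr R 0 (r / 2) (divr_gt0 r0 (ltr0n _ 2)); rewrite add0r => mr.
  have m0 : (0 : R) < m.+1%:R^-1 by rewrite invr_gt0 ltr0n.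
  have [_ [j _ <-] wj] := (closure_nrmP _ _).1 (eX w) _ m0.
  exists j => //; exists m => //; rewrite /N; case: asboolP => // nA; case: nA.
  apply: negligibleS rN => w' /=; rewrite /A /= => w'j.
  rewrite (le_lt_trans (nrmB_le _ (e j) _))// (nrm_distC (e j)).
  by move: wj w'j mr; set q := _^-1; lra.
move=> [M [mM M0 TM]].
have := probability_setT P; have -> : [set: Omega] = M by apply/seteqP; split.
by rewrite M0 => /eqP; rewrite eq_sym onee_eq0.
Qed.

End separable_range.

Section compactness_of_values.
Context (R : realType) (k : scalar_kind) d (Omega : measurableType d).
Context (P : probability Omega R) (B : normedModType (scalar_field R k)).
Implicit Types (V C : set B).

Lemma L0_convexly_compact_weakly_compact V : closed V -> real_convex V ->
  L0_convexly_compact (L0_valued P V) -> weakly_compact V.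
Proof.
move=> clV cV [_ _ cpt]; apply: weakly_compact_ultra => // F FU FV.
have FF : ProperFilter F by exact: ultra_proper.
pose D := [set C | [/\ closed C, real_convex C, C `<=` V & F C]].
pose fam := [set L0_valued P C | C in D].
have [|D' D'fam|x xfam] := cpt fam.
- move=> A [C [clC cC CV FC] <-].
  have [v Cv] := filter_ex FC; have C0 : C !=set0 by exists v.
  split.
  + by exists (\pi_(L0 P B) (cst_elt Omega v)), (cst_elt Omega v).
  + exact: closed_L0_valued.
  + exact: L0_convex_L0_valued.
  + by move=> _ [Y YC <-]; exists Y => // w; apply: CV; exact: YC.
(* Finitely many members of the ultrafilter have a common point [v], whose constant random element
   lies in the whole finite subfamily. *)
- have [A AD'|v vD'] := filter_ex (filter_bigI (D := D') (F := F) (f := fun A =>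
      [set v | A (\pi_(L0 P B) (cst_elt Omega v))]) _ _).
    have /set_mem[C [clC cC CV FC] <-] := D'fam _ AD'.
    by apply: filterS FC => v Cv; exists (cst_elt Omega v).
  exists (\pi_(L0 P B) (cst_elt Omega v)) => A AD'.
  exact: (vD' A AD').
have [b bX] := essential_value P (repr x).
have bC C : D C -> C b.
  move=> DC; have [clC _ _ FC] := DC; apply: clC; apply/closure_nrmP => r r0.
  apply: contrapT => nr; apply: (bX r r0).
  have [v Cv] := filter_ex FC; have C0 : C !=set0 by exists v.
  have : L0_valued P C (\pi_(L0 P B) (repr x)) by rewrite reprK; apply: xfam; exists C.
  move=> /(L0_valuedP _ _ C0).
  apply: negligibleS => w /= Xwb CX; apply: nr; exists (repr x w) => //.
  by rewrite nrm_distC.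
exists b; first by apply: bC; split.
by move=> C clC' cC' CV FC; apply: bC; split.
Qed.

End compactness_of_values.

(** * Countable hulls and strong measurability *)

Lemma countable_closure (T : Type) (I : countType) (op : I -> T -> T -> T)
    (e : nat -> T) : exists y : nat -> T,
  [/\ forall j, exists i, y i = e j,
      forall q a b, exists c, y c = op q (y a) (y b) &
      forall Q : T -> Prop, (forall j, Q (e j)) ->
        (forall q a b, Q a -> Q b -> Q (op q a b)) -> forall n, Q (y n)].
Proof.
(* An index of stage [m.+1] encodes either an element of stage [m] or an operation applied to two of
   them; codes that decode to nothing repeat the element of index 0. *)
pose fix st (n : nat) : nat -> T := if n is m.+1 then fun p =>
    match unpickle p : option (nat + I * nat * nat) with
    | Some (inl a) => st m a
    | Some (inr (q, a, b)) => op q (st m a) (st m b)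
    | None => st m 0%N
    end else e.
have st_le m n a : (m <= n)%N -> exists b, st n b = st m a.
  elim: n => [|n IHn]; first by rewrite leqn0 => /eqP ->; exists a.
  rewrite leq_eqVlt => /predU1P[->|]; first by exists a.
  rewrite ltnS => /IHn[b <-].
  by exists (pickle (inl b : nat + I * nat * nat)); rewrite /= pickleK.
pose y n := if unpickle n is Some (m, a) then st m a else e 0%N.
have yE m a : y (pickle (m, a)) = st m a by rewrite /y pickleK.
have yst n : exists m a, y n = st m a.
  by rewrite /y; case: unpickle => [[m a]|]; [exists m, a|exists 0%N, 0%N].
exists y; split=> [j|q a b|Q Qe Qop n].
- by exists (pickle (0%N, j)); rewrite yE.
- have [m [i ->]] := yst a; have [n [j ->]] := yst b.
  have [i' <-] := st_le _ _ i (leq_maxl m n).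
  have [j' <-] := st_le _ _ j (leq_maxr m n).
  exists (pickle ((maxn m n).+1, pickle (inr (q, i', j') : nat + I * nat * nat))).
  by rewrite yE /= pickleK.
- have Qst m : forall a, Q (st m a).
    elim: m => [//|m IHm] p /=.
    by case: unpickle => [[a|[[q a] b]]|]; [exact: IHm|apply: Qop|exact: IHm].
  by have [m [a ->]] := yst n.
Qed.

Section rational_hulls.
Context (R : realType) (k : scalar_kind) (B : normedModType (scalar_field R k)).
Implicit Types (C S : set B) (x y : B).

(** Clamping lets every rational index a convex coefficient, so that [countable_closure] applies
    without side conditions. *)
Definition weight (q : rat) : R := Num.max 0 (Num.min 1 (ratr q)).

Lemma weight01 q : 0 <= weight q <= 1.
Proof. by rewrite /weight le_max lexx/= ge_max ler01 ge_min lexx. Qed.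

Lemma weightE q : exists p : rat, weight q = ratr p.
Proof.
rewrite /weight; case: (leP 1 (ratr q : R)) => _.
  by exists 1; rewrite max_r ?ler01// rmorph1.
by case: (leP 0 (ratr q : R)) => _; [exists q|exists 0; rewrite rmorph0].
Qed.

Lemma weight_dense (t e : R) : 0 <= t <= 1 -> 0 < e ->
  exists q, `|t - weight q| < e.
Proof.
move=> /andP[t0 t1] e0.
have [q] := rat_in_itvoo (ltr_pwDr e0 (lexx t)).
rewrite in_itv/= => /andP[tq qe]; exists q.
rewrite /weight max_r ?le_min ?ler01 ?(le_trans t0 (ltW tq))//.
have [q1|q1] := leP 1 (ratr q : R).
  by rewrite ler0_norm; lra.
by rewrite ltr0_norm; lra.
Qed.

Lemma rational_convex_closure C :
  (forall q x y, C x -> C y ->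
    C (of_real k (weight q) *: x + of_real k (1 - weight q) *: y)) ->
  real_convex (closure C).
Proof.
move=> cC x y t /closure_nrmP Cx /closure_nrmP Cy t01.
apply/closure_nrmP => e e0; have e20 : 0 < e / 2 by rewrite divr_gt0.
have [x' Cx' xx] := Cx _ e20; have [y' Cy' yy] := Cy _ e20.
(* What the errors at the endpoints leave of [e / 2] is spent on the coefficient; the [1 +] avoids
   dividing by zero. *)
pose r := (e / 2 - Num.max (nrm (x - x')) (nrm (y - y'))) / (1 + nrm (x' - y')).
have m0 : 0 < e / 2 - Num.max (nrm (x - x')) (nrm (y - y')).
  by rewrite subr_gt0 gt_max xx.
have n1 : 0 < 1 + nrm (x' - y') by rewrite ltr_wpDr// nrm_ge0.
have r0 : 0 < r by rewrite divr_gt0.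
have [q tq] := weight_dense t01 r0.
exists (of_real k (weight q) *: x' + of_real k (1 - weight q) *: y'); first exact: cC.
rewrite (le_lt_trans (nrmB_le _ (of_real k t *: x' + of_real k (1 - t) *: y') _))//.
rewrite opprD addrACA -!scalerBr.
have -> : of_real k t *: x' + of_real k (1 - t) *: y' -
    (of_real k (weight q) *: x' + of_real k (1 - weight q) *: y') =
    of_real k (t - weight q) *: (x' - y').
  by rewrite !of_real_scaleB opprD addrACA subrr add0r -scalerBl -of_realB.
rewrite nrmZ.
have h1 : nrm (of_real k t *: (x - x') + of_real k (1 - t) *: (y - y')) <=
    Num.max (nrm (x - x')) (nrm (y - y')).
  rewrite (le_trans (nrmD _ _))// !nrmZ.
  have /andP[t0 t1] := t01.
  have a1 : nrm (x - x') <= Num.max (nrm (x - x')) (nrm (y - y')) by rewrite le_max lexx.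
  have a2 : nrm (y - y') <= Num.max (nrm (x - x')) (nrm (y - y')) by rewrite le_max lexx orbT.
  rewrite !ger0_norm ?subr_ge0//.
  have := ler_wpM2l t0 a1; have t10 : 0 <= 1 - t by lra.
  by have := ler_wpM2l t10 a2; set m := Num.max _ _; lra.
have h2 : `|t - weight q| * nrm (x' - y') < e / 2 - Num.max (nrm (x - x')) (nrm (y - y')).
  apply: le_lt_trans (_ : _ <= `|t - weight q| * (1 + nrm (x' - y'))) _.
    by rewrite ler_wpM2l// lerDr.
  by rewrite -ltr_pdivlMr.
by move: h1 h2; set m := Num.max _ _; lra.
Qed.

Lemma closure_range_enough (e : nat -> B) x : closure (range e) x <->
  forall r : R, 0 < r -> exists j, nrm (x - e j) < r.
Proof.
split=> [/closure_nrmP h r r0|h].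
  by have [_ [j _ <-] ?] := h r r0; exists j.
by apply/closure_nrmP => r r0; have [j ?] := h r r0; exists (e j) => //; exists j.
Qed.

(** [D] is closed under differences and [u i] attains the norm at [D i]. As [D a - D j] is again
    some [D i], the [u i] norm every [x - D j] with [x] in the closure of [D]: distances to [D]
    become countable suprema. *)
Lemma norming_sequence (e : nat -> B) : exists (D : nat -> B) (u : nat -> B -> R),
  [/\ forall j, exists i, D i = e j, real_convex (closure (range D)),
      forall i, contraction (u i) &
      forall x j (r : R), closure (range D) x -> r < nrm (x - D j) ->
        exists i, r < u i x - u i (D j)].
Proof.
have [D [De Dop _]] := @countable_closure B rat
  (fun q a b => a + of_real k (ratr q) *: b) e.
have /choice[u uP] : forall i, exists v, contraction v /\ v (D i) = nrm (D i).
  by move=> i; have [v cv vD] := norming (D i); exists v.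
have DB a b : exists c, D c = D a - D b.
  have [c Dc] := Dop (-1) a b; exists c.
  by rewrite Dc rmorphN1 of_realN of_real1 scaleN1r.
exists D, u; split=> //.
- apply: rational_convex_closure => q _ _ [a _ <-] [b _ <-].
  have [p ->] := weightE q; rewrite of_real_scaleB.
  have [c <-] := DB a b; have [i <-] := Dop p b c; by exists i.
- by move=> i; have [] := uP i.
- move=> x j r /closure_range_enough xD rx.
  (* Halved because [nrm (x - D a)] is paid twice, once in the norm and once in the value of the
     functional. *)
  have e0 : 0 < (nrm (x - D j) - r) / 2 by rewrite divr_gt0// subr_gt0.
  have [a xa] := xD _ e0; have [i ij] := DB a j; exists i.
  have [cu ui] := uP i; rewrite -contractionB//.
  rewrite -(subrKA (D a)) contractionD// -ij ui ij.
  have := contraction_abs cu (x - D a); rewrite ler_norml => /andP[+ _].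
  have := nrmB_le x (D a) (D j); move: xa; lra.
Qed.

End rational_hulls.

Section pettis.
Context (R : realType) (k : scalar_kind) d (Omega : measurableType d).
Context (B : normedModType (scalar_field R k)).
Variables (X : Omega -> B) (e : nat -> B).
Hypothesis eX : forall w, closure (range e) (X w).
Hypothesis mX : forall j, measurable_fun setT (fun w => nrm (X w - e j)).

Fixpoint nearest n w : nat := if n is m.+1 then
    let i := nearest m w in if nrm (X w - e m.+1) < nrm (X w - e i) then m.+1 else i
  else 0%N.

Lemma nearest_le n w : (nearest n w <= n)%N.
Proof. by elim: n => //= n IHn; case: ifP => // _; exact: leqW. Qed.

Lemma nearestP n w j : (j <= n)%N ->
  nrm (X w - e (nearest n w)) <= nrm (X w - e j).
Proof.
elim: n => [|n IHn] in j *; first by rewrite leqn0 => /eqP ->.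
rewrite /= leq_eqVlt => /predU1P[->|]; first by case: ifP => // /negbT; rewrite -leNgt.
by rewrite ltnS => /IHn jn; case: ifP => // /ltW h; exact: le_trans jn.
Qed.

Lemma measurable_nearest n j : measurable [set w | nearest n w = j].
Proof.
have mlt a b : measurable [set w | nrm (X w - e a) < nrm (X w - e b)].
  have := measurable_fun_ltr (mX a) (mX b) measurableT (Y := [set true]) I.
  by rewrite setTI.
elim: n => [|n IHn] in j *.
  have [->|j0] := eqVneq j 0%N; first by rewrite (_ : mkset _ = setT)//; apply/seteqP; split.
  rewrite (_ : mkset _ = set0)//; apply/seteqP; split=> // w /= h.
  by move: j0; rewrite -h eqxx.
rewrite (_ : mkset _ = \bigcup_i ([set w | nearest n w = i] `&`
   if `[< j = n.+1 >] then [set w | nrm (X w - e n.+1) < nrm (X w - e i)]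
   else if `[< j = i >] then ~` [set w | nrm (X w - e n.+1) < nrm (X w - e i)] else set0)).
  apply: bigcup_measurable => i _; apply: measurableI => //.
  by case: asboolP => // _; case: asboolP => // _; exact: measurableC.
apply/seteqP; split=> [w /= h|w [i _ [/= <-]]].
  exists (nearest n w) => //; split=> //; move: h; case: ifP => [lt <-|lt <-].
    by case: asboolP.
  case: asboolP => [h|_]; first by have := nearest_le n w; rewrite h ltnn.
  by case: asboolP => //= _; rewrite lt.
case: asboolP => [-> /= ->//|_]; case: asboolP => [-> /= /negP/negbTE ->//|_ []].
Qed.

(** The nearest among the first [n.+1] points of [e] gives a simple approximation. Finding it only
    compares distances, so their measurability suffices. *)
Lemma pettis : strong_random_element X.
Proof.
exists (fun n w => e (nearest n w)); split=> [n|w].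
  have fX : finite_set (range (nearest n)).
    apply: (sub_finite_set _ (finite_II n.+1)) => _ [w _ <-] /=.
    by rewrite ltnS nearest_le.
  split=> [G _|].
    apply: (@finite_fibers_measurable _ _ _ (nearest n) (e @^-1` G)) => //.
    exact: measurable_nearest.
  apply: sub_finite_set (finite_image e fX).
  by move=> _ [w _ <-]; exists (nearest n w) => //; exists w.
apply/cvg_nrmP => r r0; have [j xj] := (closure_range_enough _ _).1 (@eX w) r r0.
by exists j => n jn; exact: le_lt_trans (nearestP w jn) xj.
Qed.

End pettis.

(** * Cauchy criteria: near-minimizers and summable increments *)

Section minimizing_sequences.
Context (R : realType).

(* As for projections in a Hilbert space, the midpoint inequality makes minimizing *)
(* sequences of J Cauchy for every q i.                                            *)
Lemma minimizing_sequence (T : Type) (F : nat -> set T) (J : T -> R)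
    (mid : T -> T -> T) (q : nat -> T -> T -> R) :
  (forall n, F n !=set0) -> (forall m n, (m <= n)%N -> F n `<=` F m) ->
  (forall n x y, F n x -> F n y -> F n (mid x y)) ->
  (forall x, F 0%N x -> 0 <= J x <= 1) ->
  (forall i x y, F 0%N x -> F 0%N y -> J (mid x y) + q i x y <= (J x + J y) / 2) ->
  exists z : nat -> T, (forall n, F n (z n)) /\
    forall i m n, (m <= n)%N -> q i (z m) (z n) <= 2 * (8^-1) ^+ m.
Proof.
move=> F0 Fle Fmid J01 Jq.
pose a n := inf (J @` F n).
have lbJ n : lbound (J @` F n) 0.
  by move=> _ [x Fx <-]; have /andP[] := J01 x (Fle _ _ (leq0n n) _ Fx).
have aJ n x : F n x -> a n <= J x.
  by move=> Fx; apply: ge_inf; [exists 0|exists x].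
have Ja n e : 0 < e -> exists2 x, F n x & J x < a n + e.
  move=> e0; have [|_ [x Fx <-] xe] := inf_adherent e0 (E := J @` F n).
    by split; [have [x Fx] := F0 n; exists (J x), x|exists 0].
  by exists x.
have a1 n : a n <= 1.
  have [x Fx] := F0 n; apply: le_trans (aJ n x Fx) _.
  by have /andP[] := J01 x (Fle _ _ (leq0n n) _ Fx).
(* The infima [a n] increase and are bounded by 1, so [s] is their limit. *)
pose s := sup (range a).
have sup_a : has_sup (range a) by split; [exists (a 0%N), 0%N|exists 1 => _ [n _ <-]].
have as_ n : a n <= s by apply: sup_upper_bound => //; exists n.
have a_le m n : (m <= n)%N -> a m <= a n.
  move=> mn; apply: lb_le_inf; first by have [x Fx] := F0 n; exists (J x), x.
  by move=> _ [x Fx <-]; apply: aJ; exact: Fle mn _ Fx.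
have pos8 n : (0 : R) < 8^-1 ^+ n by rewrite exprn_gt0// invr_gt0 ltr0n.
(* Going to a later [F p], where the infimum already exceeds [s - 8^-1 ^+ n], also controls
   midpoints from below: that of [z m] and [z n] lies in [F (minn p p')]. *)
have /choice[z zP] : forall n, exists x : T, exists2 p, (n <= p)%N &
    [/\ F p x, J x < s + 8^-1 ^+ n & s - 8^-1 ^+ n < a p].
  move=> n; have [_ [p _ <-] sp] := sup_adherent (pos8 n) sup_a.
  have {}sp : s - 8^-1 ^+ n < a (maxn n p).
    by apply: lt_le_trans sp _; apply: a_le; exact: leq_maxr.
  have [x Fx xa] := Ja (maxn n p) _ (pos8 n); exists x, (maxn n p); first exact: leq_maxl.
  by split=> //; apply: lt_le_trans xa _; rewrite lerD2r.
exists z; split=> [n|i m n mn].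
  by have [p np [Fp _ _]] := zP n; exact: Fle np _ Fp.
have [p mp [Fp Jp sp]] := zP m; have [p' np' [Fp' Jp' sp']] := zP n.
have mn8 : (8^-1 : R) ^+ n <= 8^-1 ^+ m.
  by apply: ler_wiXn2l => //; lra.
have F1 : F (minn p p') (mid (z m) (z n)).
  by apply: Fmid; [exact: Fle (geq_minl _ _) _ Fp|exact: Fle (geq_minr _ _) _ Fp'].
have J1 : s - 8^-1 ^+ m < J (mid (z m) (z n)).
  apply: lt_le_trans (aJ _ _ F1); rewrite /minn; case: ifP => // _.
  by apply: le_lt_trans sp'; lra.
have := Jq i (z m) (z n) (Fle _ _ (leq0n _) _ Fp) (Fle _ _ (leq0n _) _ Fp'); lra.
Qed.

Lemma summable_increments_cvg (x : nat -> R) (N : nat) :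
  (forall n, (N <= n)%N -> `|x n - x n.+1| < 2^-1 ^+ n) -> cvgn x.
Proof.
move=> h.
have pos n : (0 : R) < 2^-1 ^+ n by rewrite exprn_gt0// invr_gt0 ltr0n.
have tail n j : (N <= n)%N -> `|x n - x (n + j)%N| <= 2 * 2^-1 ^+ n - 2 * 2^-1 ^+ (n + j).
  move=> Nn; elim: j => [|j IHj]; first by rewrite addn0 !subrr normr0.
  have := h (n + j)%N (leq_trans Nn (leq_addr _ _)).
  have := ler_distD (x (n + j)%N) (x n) (x (n + j.+1)%N).
  rewrite addnS exprS; move: IHj; set a := 2^-1 ^+ _; lra.
apply/cauchy_cvgP/cauchy_exP => e e0.
have [n Nn ne] : exists2 n, (N <= n)%N & 2 * 2^-1 ^+ n < e.
  have : (2^-1 : R) ^+ n @[n --> \oo] --> 0 by apply: cvg_expr; rewrite gtr0_norm; lra.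
  move=> /cvgrPdist_lt/(_ (e / 2)); rewrite divr_gt0// => /(_ isT)[M _ MP].
  exists (maxn N M); first exact: leq_maxl.
  have := MP (maxn N M) (leq_maxr _ _); rewrite /= sub0r normrN gtr0_norm//; lra.
exists (x n); exists n => // m /= nm.
rewrite /ball /= -(subnKC nm).
by apply: le_lt_trans (tail n _ Nn) _; have := pos (n + (m - n))%N; lra.
Qed.

End minimizing_sequences.

(** * Admissible sets of random elements *)

Section closed_hulls.
Context (R : realType) (k : scalar_kind) (B : normedModType (scalar_field R k)).
Implicit Types (C S : set B).

Definition closed_hull S : set B :=
  [set x | forall C, closed C -> real_convex C -> S `<=` C -> C x].

Lemma sub_closed_hull S : S `<=` closed_hull S.
Proof. by move=> x Sx C _ _ SC; exact: SC. Qed.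

Lemma closed_closed_hull S : closed (closed_hull S).
Proof.
move=> x hx C clC cC SC; apply: (clC) => A /hx[y [hy Ay]].
by exists y; split=> //; exact: (hy C clC cC SC).
Qed.

Lemma real_convex_closed_hull S : real_convex (closed_hull S).
Proof.
move=> x y t hx hy t01 C clC cC SC.
exact: (cC _ _ _ (hx C clC cC SC) (hy C clC cC SC) t01).
Qed.

Lemma closed_hull_subset S S' : S `<=` S' -> closed_hull S `<=` closed_hull S'.
Proof. by move=> SS x hx C clC cC SC; exact: (hx C clC cC (subset_trans SS SC)). Qed.

End closed_hulls.

Section admissible_sets.
Context (R : realType) (k : scalar_kind) d (Omega : measurableType d).
Context (P : probability Omega R) (B : normedModType (scalar_field R k)).
Variable V : set B.
Local Notation strong_elt := (strong_elt Omega B).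
Implicit Types (X Y Z : strong_elt) (G : set strong_elt) (A C : set Omega) (xi : {mfun Omega >-> R}).

(* The V-valued representatives of a closed L0-convex subset of L0_valued P V. *)
Definition admissible G :=
  [/\ forall X, G X -> forall w, V (X w),
      forall xi X Y, (forall w, 0 <= xi w <= 1) -> G X -> G Y -> G (mix xi X Y) &
      forall X, (forall w, V (X w)) -> (forall e : R, 0 < e ->
        exists2 Y, G Y & \int[P]_w truncated X Y w < e) -> G X].

Lemma admissible_glue G A (mA : measurable A) X Y : admissible G ->
  G X -> G Y -> G (glue mA X Y).
Proof.
move=> [_ mG _] GX GY; apply: mG => // w.
have -> : (mindic R mA : {mfun Omega >-> R}) w = (w \in A)%:R by rewrite /= mindicE.
by case: (w \in A); rewrite lexx ler01.
Qed.

Lemma admissible_bigcap (F : nat -> set strong_elt) :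
  (forall n, admissible (F n)) -> admissible (\bigcap_n F n).
Proof.
move=> aF; split.
- by move=> X FX; have [+ _ _] := aF 0%N; apply; exact: FX.
- move=> xi X Y xi01 FX FY n _; have [_ + _] := aF n.
  by apply=> //; [exact: FX|exact: FY].
- move=> X VX h n _; have [_ _] := aF n; apply=> // e e0.
  by have [Y FY XY] := h e e0; exists Y => //; exact: FY.
Qed.

Lemma Rintegral_truncated_glue A (mA : measurable A) C X Y Z : 
  (C `<=` A -> \int[P]_(w in C) truncated (glue mA X Y) Z w = \int[P]_(w in C) truncated X Z w) /\
  (C `<=` ~` A -> \int[P]_(w in C) truncated (glue mA X Y) Z w = \int[P]_(w in C) truncated Y Z w).
Proof.
split=> CA; apply: eq_Rintegral => w /set_mem /CA Aw; rewrite /truncated.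
  by rewrite glue_in.
by rewrite glue_out.
Qed.

(** A local test for membership. The [A j] are made disjoint and good members of [G] are pasted on
    finitely many of the pieces; the bounds add up because [e * fine (P C)] is additive in [C]. On
    the small remaining set the truncation at 1 bounds the error. The slack [r] admits a [Z] that
    only nearly attains an infimum. *)
Lemma admissible_patch G X : admissible G -> (forall w, V (X w)) ->
  (forall e : R, 0 < e -> exists A : nat -> set Omega,
    [/\ forall j, measurable (A j), P.-negligible (~` \bigcup_j A j) &
        forall j C (r : R), measurable C -> C `<=` A j -> 0 < r ->
          exists2 Z, G Z &
            \int[P]_(w in C) truncated Z X w <= e * fine (P C) + r]) ->
  G X.
Proof.
move=> aG VX h; have [_ _] := aG; apply=> // e e0.
(* The parts are the rate on [U n], the accumulated slack and the probability of the remainder;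
   three of the four quarters are spent. *)
have e40 : 0 < e / 4 by rewrite divr_gt0.
have [A [mA NA AZ]] := h _ e40.
pose fix U n := if n is m.+1 then U m `|` A m else set0.
have mU n : measurable (U n) by elim: n => //= n IHn; exact: measurableU.
have bt := @bounded_truncated R k d Omega B.
have patch n : forall r : R, 0 < r -> exists2 Z, G Z &
    \int[P]_(w in U n) truncated Z X w <= e / 4 * fine (P (U n)) + r.
  elim: n => [|n IHn] r r0.
    have [Z GZ _] := AZ 0%N set0 r measurable0 (@sub0set _ _) r0.
    by exists Z => //=; rewrite Rintegral_set0 measure0 mulr0 add0r ltW.
  have r20 : 0 < r / 2 by rewrite divr_gt0.
  have [Z1 GZ1 h1] := IHn _ r20.
  have mD : measurable (A n `\` U n) by exact: measurableD.
  have [|Z2 GZ2 h2] := AZ n _ (r / 2) mD _ r20; first exact: subDsetl.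
  exists (glue (mU n) Z1 Z2); first exact: admissible_glue.
  have UE : U n.+1 = U n `|` (A n `\` U n) by rewrite /= setUDr setDv setD0.
  have dis : U n `&` (A n `\` U n) = set0 by exact: setDIK.
  rewrite UE Rintegral_cat// measureU// fineD; [|exact: fin_num_measure..].
  rewrite (Rintegral_truncated_glue _ _ _ _ _).1//.
  rewrite (Rintegral_truncated_glue _ _ _ _ _).2; last by move=> w [].
  rewrite mulrDr; lra.
have [n Pn] : exists n, fine (P (~` U n)) < e / 4.
  have mUU : measurable (\bigcup_n U n) by exact: bigcup_measurable.
  have UU1 : P (\bigcup_n U n) = 1%E.
    have : P.-negligible (~` \bigcup_n U n).
      apply: negligibleS NA; apply: subsetC => w [j _ Aj].
      by exists j.+1 => //=; right.
    move=> /(negligibleP _ (measurableC mUU)) N0.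
    have := probability_setC P (measurableC mUU); rewrite setCK N0 sube0.
    by [].
  have ndU : {homo U : n m / (n <= m)%N >-> (n <= m)%O}.
    by apply/nondecreasing_seqP => n; apply/subsetPset => w /=; left.
  have : P (U n) @[n --> \oo] --> 1%E.
    by rewrite -UU1; exact: nondecreasing_cvg_mu.
  move=> /fine_cvgP[_ /cvgrPdist_lt/(_ _ e40)[n _ /(_ n (leqnn n))]] /= hn.
  exists n; rewrite fine_probability_setC//.
  exact: le_lt_trans (ler_norm _) hn.
have [Z GZ ZX] := patch n _ e40; exists Z => //; rewrite truncatedC.
rewrite -(setUv (U n)) Rintegral_cat//; [|exact: measurableC|exact: setICr].
have h1 : e / 4 * fine (P (U n)) <= e / 4.
  by rewrite ler_piMr ?(ltW e40)// fine_probability_le1.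
have h2 : \int[P]_(w in ~` U n) truncated Z X w <= 1 * fine (P (~` U n)).
  apply: Rintegral_le_cst; [exact: measurableC|by []|].
  by move=> w _; rewrite ge_min lexx.
move: ZX Pn; lra.
Qed.

Lemma admissible_selection G (y : nat -> strong_elt) X : admissible G ->
  (forall j, G (y j)) -> (forall w, V (X w)) ->
  {ae P, forall w, closure (range (fun j => y j w)) (X w)} -> G X.
Proof.
move=> aG Gy VX yX; apply: admissible_patch => // e e0.
exists (fun j => [set w | nrm ((y j - X) w) < e]); split.
- by move=> j; exact: measurable_nrm_lt.
- apply: negligibleS yX => w /= nw h; apply: nw.
  have [j yj] := (closure_range_enough _ _).1 h e e0.
  by exists j => //=; rewrite nrm_distC.
- move=> j C r mC Cj r0; exists (y j) => //.
  apply: (@le_trans _ _ (e * fine (P C))); last by rewrite lerDl ltW.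
  apply: Rintegral_le_cst => //; first exact: bounded_truncated.
  by move=> w /Cj /= /ltW h; rewrite ge_min h orbT.
Qed.

Lemma hull_generators (x : nat -> strong_elt) : exists y : nat -> strong_elt,
  [/\ forall j, exists i, y i = x j,
      forall q a b, exists c, y c = mix (cst (weight R q)) (y a) (y b) &
      forall G, (forall xi X Y, (forall w, 0 <= xi w <= 1) -> G X -> G Y -> G (mix xi X Y)) ->
        (forall j, G (x j)) -> forall n, G (y n)].
Proof.
have [y [y1 y2 y3]] := @countable_closure strong_elt rat
  (fun q X Y => mix (cst (weight R q)) X Y) x.
exists y; split=> // G mG Gx; apply: y3 => // q X Y GX GY; apply: mG => // w.
exact: weight01.
Qed.

Lemma mix_closed_convex (y : nat -> strong_elt) w :
  (forall q a b, exists c, y c = mix (cst (weight R q)) (y a) (y b)) ->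
  real_convex (closure (range (fun j => y j w))).
Proof.
move=> ymix; apply: rational_convex_closure => q _ _ [a _ <-] [b _ <-].
by have [c yc] := ymix q a b; exists c => //; rewrite yc mixE.
Qed.

(** The rational mixtures of the [x j] form a countable subset of [G]. Their values at [w] have a
    closed convex closure, which therefore contains the hull, and [admissible_selection] pastes them
    into approximations of [X]. *)
Lemma admissible_hull G (x : nat -> strong_elt) X : admissible G ->
  (forall j, G (x j)) -> (forall w, V (X w)) ->
  {ae P, forall w, closed_hull (range (fun j => x j w)) (X w)} -> G X.
Proof.
move=> aG Gx VX xX; have [_ mG _] := aG.
have [y [yx ymix yG]] := hull_generators x.
apply: (admissible_selection aG (yG G mG Gx) VX).
apply: filterS xX => w; apply.
- exact: closed_closure.
- exact: mix_closed_convex.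
- move=> _ [j _ <-]; apply: subset_closure.
  by have [i <-] := yx j; exists i.
Qed.

End admissible_sets.

(** * Weak limits of random elements *)

Section weakly_compact_bounds.
Context (R : realType) (k : scalar_kind) (B : normedModType (scalar_field R k)).
Variables (V : set B) (wV : weakly_compact V).

Lemma weakly_compact_bounded (u : B -> R) : contraction u ->
  exists2 M : R, 0 < M & forall v, V v -> `|u v| <= M.
Proof.
move=> cu; apply: contrapT => h.
have /choice[x xP] : forall n : nat, exists v, V v /\ n%:R < `|u v|.
  move=> n; apply: contrapT => nv; apply: h; exists (n%:R + 1) => [|v Vv].
    by rewrite ltr_wpDl.
  rewrite leNgt; apply/negP => nu; apply: nv; exists v; split=> //.
  by rewrite (lt_trans _ nu)// ltrDl.
have [y Vy /(_ u cu 1 ltr01)] := weakly_compact_cluster wV (fun n => (xP n).1).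
move=> /(_ (Num.truncn (`|u y| + 1)).+1)[m ym xy].
have := truncnS_gt (`|u y| + 1); have := (xP m).2.
have : ((Num.truncn (`|u y| + 1)).+1%:R : R) <= m%:R by rewrite ler_nat.
have := ler_distD 0 (u (x m)) (u y); rewrite !subr0 sub0r normrN => _.
have := lerB_dist (u (x m)) (u y); lra.
Qed.

End weakly_compact_bounds.

Lemma ae_forall_nat (R : realType) d (Omega : measurableType d)
    (P : probability Omega R) (Q : nat -> Omega -> Prop) :
  (forall n, {ae P, forall w, Q n w}) -> {ae P, forall w, forall n, Q n w}.
Proof.
move=> QP; have := negligible_bigcup QP; apply: negligibleS => w /= /existsNP[n nQ].
by exists n.
Qed.

Section mean_squares.
Context (R : realType) d (Omega : measurableType d) (P : probability Omega R).
Implicit Types (f g : Omega -> R).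

(** The source of strict convexity: the term with [f w - g w] is what a near-minimizer's midpoint
    cannot afford. *)
Lemma parallelogram f g : bounded_rv f -> bounded_rv g ->
  \int[P]_w ((f w + g w) / 2) ^+ 2 + (\int[P]_w (f w - g w) ^+ 2) / 4 =
  (\int[P]_w f w ^+ 2 + \int[P]_w g w ^+ 2) / 2.
Proof.
move=> bf bg.
have int h : bounded_rv h -> P.-integrable setT (EFin \o h).
  by move=> bh; exact: bounded_rv_integrable.
have bfg := bounded_rvD bf bg.
have bd : bounded_rv (fun w => f w - g w).
  have := bounded_rvD bf (bounded_rvZ (-1) bg); congr bounded_rv.
  by apply/funext => w; rewrite mulN1r.
have b2 h (c : R) : bounded_rv h -> \int[P]_w (c * h w) = c * \int[P]_w h w.
  by move=> bh; apply: RintegralZl => //; exact: int.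
have bf2 := bounded_rv_sqr bf; have bg2 := bounded_rv_sqr bg.
have bs2 := bounded_rv_sqr bfg; have bd2 := bounded_rv_sqr bd.
have -> : \int[P]_w ((f w + g w) / 2) ^+ 2 = 4^-1 * \int[P]_w (f w + g w) ^+ 2.
  by rewrite -b2//; apply: eq_Rintegral => w _; field.
rewrite [X in _ + X]mulrC.
rewrite -mulrDr -RintegralD//; [|exact: int..].
rewrite -RintegralD//; [|exact: int..].
have -> : \int[P]_w ((f w + g w) ^+ 2 + (f w - g w) ^+ 2) =
    2 * \int[P]_w (f w ^+ 2 + g w ^+ 2).
  rewrite -b2; last exact: bounded_rvD.
  by apply: eq_Rintegral => w _; ring.
by field.
Qed.

(* Chebyshev and Borel-Cantelli. *)
Lemma ae_cvg_of_mean_square (f : nat -> Omega -> R) (K : R) :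
  (forall n, bounded_rv (f n)) ->
  (forall n, \int[P]_w (f n w - f n.+1 w) ^+ 2 <= K * 8^-1 ^+ n) ->
  {ae P, forall w, cvgn (f^~ w)}.
Proof.
move=> bf fK.
have bd n : bounded_rv (fun w => (f n w - f n.+1 w) ^+ 2).
  apply: bounded_rv_sqr.
  have := bounded_rvD (bf n) (bounded_rvZ (-1) (bf n.+1)); congr bounded_rv.
  by apply/funext => w; rewrite mulN1r.
(* Mean squares of order 8^-n against the threshold 4^-n leave probabilities of order 2^-n, and off
   [A n] the increments are below 2^-n: both are summable. *)
pose A n := [set w | 4^-1 ^+ n <= (f n w - f n.+1 w) ^+ 2].
have mark n := Rintegral_markov P (4^-1 ^+ n) (bd n) (fun w => sqr_ge0 _).
have mA n : measurable (A n) by have [] := mark n.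
have K0 : 0 <= K.
  have := fK 0%N; rewrite expr0 mulr1; apply: le_trans; apply: Rintegral_ge0 => w _.
  exact: sqr_ge0.
have PA n : (P (A n) <= (2 * K / (2 ^ (n + 1))%:R)%:E)%E.
  rewrite -(fineK (fin_num_measure P _ (mA n))) lee_fin.
  have [_ h] := mark n; have {h} := le_trans h (fK n); rewrite -/(A n).
  have p4 : (0 : R) < 4^-1 ^+ n by rewrite exprn_gt0// invr_gt0 ltr0n.
  rewrite -ler_pdivlMl// => h; apply: (le_trans h).
  rewrite addn1 expnS natrM natrX -exprVn invrK.
  have -> : (8^-1 : R) ^+ n = 4^-1 ^+ n * 2^-1 ^+ n.
    by rewrite -exprMn; congr (_ ^+ _); lra.
  rewrite [leLHS](_ : _ = K * 2^-1 ^+ n * (4 ^+ n * 4^-1 ^+ n)); last by ring.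
  rewrite -exprMn divff// expr1n mulr1 exprVn.
  have p2 : (0 : R) < 2 ^+ n by rewrite exprn_gt0.
  by rewrite invfM mulrA [X in _ <= X * _](_ : _ = K)//; field.
have lim0 : P (lim_sup_set A) = 0%E.
  apply: lim_sup_set_cvg0 => //.
  apply: (@le_lt_trans _ _ (\sum_(0 <= n <oo) (2 * K / (2 ^ (n + 1))%:R)%:E)%E).
    by apply: lee_nneseries => // n _; exact: PA.
  have -> : (\sum_(0 <= n <oo) (2 * K / (2 ^ (n + 1))%:R)%:E)%E = (2 * K / 2 ^+ 0)%:E.
    by apply/cvg_lim => //; exact: cvg_geometric_eseries_half.
  by rewrite ltry.
have mL : measurable (lim_sup_set A).
  by apply: bigcap_measurable => // n _; apply: bigcup_measurable.
exists (lim_sup_set A); split=> // w /= nc n _.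
apply: contrapT => nA; apply: nc.
apply: (@summable_increments_cvg R _ n) => m nm.
rewrite ltNge; apply/negP => h; apply: nA; exists m => //.
rewrite /A /= -(real_normK (num_real _)) (_ : 4^-1 = 2^-1 ^+ 2); last by field.
by rewrite exprAC lerXn2r// nnegrE// exprn_ge0// invr_ge0.
Qed.

End mean_squares.

Section weak_limits.
Context (R : realType) (k : scalar_kind) d (Omega : measurableType d).
Context (P : probability Omega R) (B : normedModType (scalar_field R k)).
Variables (V : set B) (wV : weakly_compact V) (cV : real_convex V).
Local Notation strong_elt := (strong_elt Omega B).
Implicit Types (X Y Z : strong_elt).

Lemma common_separable_range (x : nat -> strong_elt) (v : B) :
  exists e : nat -> B, closure (range e) v /\
    forall n w, closure (range e) (x n w).
Proof.
have /choice[e eP] : forall n, exists e : nat -> B, forall w, closure (range e) (x n w).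
  by move=> n; have [e eP] := separable_range (x n); exists e.
pose f p := if p is p'.+1 then
  (if unpickle p' is Some (n, j) then e n j else v) else v.
exists f; split; first by apply: subset_closure; exists 0%N.
move=> n w; apply: closure_subset (eP n w) => _ [j _ <-].
by exists (pickle (n, j)).+1 => //=; rewrite pickleK.
Qed.

Lemma bounded_contraction (u : B -> R) X : contraction u ->
  (forall w, V (X w)) -> bounded_rv (fun w => u (X w)).
Proof.
move=> cu VX; split; first exact: (measurable_random X (continuous_contraction cu)).
by have [M _ uM] := weakly_compact_bounded wV cu; exists M => w; apply: uM.
Qed.

Lemma V_mix (xi : {mfun Omega >-> R}) X Y : (forall w, 0 <= xi w <= 1) ->
  (forall w, V (X w)) -> (forall w, V (Y w)) -> forall w, V (mix xi X Y w).
Proof. by move=> xi01 VX VY w; rewrite mixE; exact: (cV (VX w) (VY w) (xi01 w)). Qed.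

Lemma half_sum (n : nat) : \sum_(i < n) (2^-1 : R) ^+ i.+1 = 1 - 2^-1 ^+ n.
Proof.
elim: n => [|n IHn]; first by rewrite big_ord0 subrr.
by rewrite big_ord_recr /= IHn exprS; field.
Qed.

(* z n nearly minimizes over F n a convergent positive combination of the mean *)
(* squares of the u i.                                                         *)
Lemma mean_square_minimizers (u : nat -> B -> R) (F : nat -> set strong_elt) :
  (forall i, contraction (u i)) ->
  (forall n, F n !=set0) -> (forall m n, (m <= n)%N -> F n `<=` F m) ->
  (forall X, F 0%N X -> forall w, V (X w)) ->
  (forall n X Y, F n X -> F n Y -> F n (mix (cst 2^-1) X Y)) ->
  exists z : nat -> strong_elt, (forall n, F n (z n)) /\
    forall i, {ae P, forall w, cvgn (fun n => u i (z n w))}.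
Proof.
move=> cu F0 Fle FV Fmid.
have /choice[M MP] : forall i, exists M : R, 0 < M /\ forall v, V v -> `|u i v| <= M.
  by move=> i; have [M M0 uM] := weakly_compact_bounded wV (cu i); exists M.
(* Normalized so that the [i]-th term is at most [2^-1 ^+ i.+1], which bounds the functional [J] by
   1. *)
pose c i : R := 2^-1 ^+ i.+1 / M i ^+ 2.
have c0 i : 0 < c i.
  by rewrite divr_gt0// exprn_gt0// ?invr_gt0 ?ltr0n//; have [] := MP i.
pose b i X : R := \int[P]_w (u i (X w)) ^+ 2.
have b0 i X : 0 <= b i X by apply: Rintegral_ge0 => w _; exact: sqr_ge0.
have cb i X : F 0%N X -> c i * b i X <= 2^-1 ^+ i.+1.
  move=> /FV VX; have [M0 uM] := MP i.
  have : b i X <= M i ^+ 2 * fine (P setT).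
    apply: Rintegral_le_cst => //; first exact/bounded_rv_sqr/bounded_contraction.
    move=> w _; rewrite -(real_normK (num_real _)) lerXn2r// ?nnegrE// ?(ltW M0)//.
    exact: uM.
  rewrite probability_setT /= mulr1 => bM.
  have p2 : (0 : R) < 2^-1 ^+ i.+1 by rewrite exprn_gt0// invr_gt0 ltr0n.
  by rewrite /c mulrAC ler_pdivrMr ?exprn_gt0// ler_pM2l.
pose S n X : R := \sum_(i < n) c i * b i X.
have S1 n X : F 0%N X -> S n X <= 1.
  move=> FX; apply: (@le_trans _ _ (\sum_(i < n) 2^-1 ^+ i.+1)).
    by apply: ler_sum => i _; exact: cb.
  by rewrite half_sum lerBlDr lerDl exprn_ge0// invr_ge0.
have Sle m n X : (m <= n)%N -> S m X <= S n X.
  elim: n => [|n IHn]; first by rewrite leqn0 => /eqP ->.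
  rewrite leq_eqVlt => /predU1P[->//|]; rewrite ltnS => /IHn mn.
  rewrite (le_trans mn)// /S big_ord_recr /= lerDl mulr_ge0// ltW//.
pose J X := sup (range (S^~ X)).
have supS X : F 0%N X -> has_sup (range (S^~ X)).
  by move=> FX; split; [exists (S 0%N X), 0%N|exists 1 => _ [n _ <-]; exact: S1].
have SJ n X : F 0%N X -> S n X <= J X.
  by move=> /supS sX; apply: sup_upper_bound => //; exists n.
pose q i X Y := c i * ((\int[P]_w (u i (X w) - u i (Y w)) ^+ 2) / 4).
have q0 i X Y : 0 <= q i X Y.
  rewrite mulr_ge0 ?(ltW (c0 i))// divr_ge0//; apply: Rintegral_ge0 => w _.
  exact: sqr_ge0.
have par i X Y : F 0%N X -> F 0%N Y ->
    c i * b i (mix (cst 2^-1) X Y) + q i X Y = (c i * b i X + c i * b i Y) / 2.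
  move=> /FV VX /FV VY; rewrite -mulrDr.
  have -> : b i (mix (cst 2^-1) X Y) = \int[P]_w ((u i (X w) + u i (Y w)) / 2) ^+ 2.
    apply: eq_Rintegral => w _; congr (_ ^+ 2).
    rewrite mixE (contractionD (cu i)) !(contractionZ (cu i)) /=.
    by field.
  rewrite (parallelogram P (bounded_contraction (cu i) VX) (bounded_contraction (cu i) VY)).
  by rewrite -mulrDr mulrA.
have [||z [zF zq]] := @minimizing_sequence R _ F J (mix (cst 2^-1)) q F0 Fle Fmid.
- move=> X FX; apply/andP; split.
    by apply: le_trans (SJ 0%N X FX); rewrite /S big_ord0.
  by apply: ge_sup => [|_ [n _ <-]]; [exists (S 0%N X), 0%N|exact: S1].
- move=> i X Y FX FY; rewrite -lerBrDr.
  apply: ge_sup => [|_ [n _ <-]]; first by exists (S 0%N (mix (cst 2^-1) X Y)), 0%N.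
  (* The partial sum is lengthened until it contains the term of index [i], whose defect [q i] is
     wanted. *)
  apply: le_trans (Sle _ _ _ (leq_maxl n i.+1)) _; rewrite lerBrDr.
  set m := maxn n i.+1; have im : (i < m)%N by rewrite leq_maxr.
  apply: (@le_trans _ _ ((S m X + S m Y) / 2)); last first.
    by have := SJ m X FX; have := SJ m Y FY; lra.
  have -> : (S m X + S m Y) / 2 = S m (mix (cst 2^-1) X Y) + \sum_(j < m) q j X Y.
    rewrite -!big_split /= mulr_suml; apply: eq_bigr => j _.
    by rewrite par.
  by rewrite lerD2l (bigD1 (Ordinal im)) //= lerDl sumr_ge0.
exists z; split=> // i; apply: (@ae_cvg_of_mean_square _ _ _ P _ (8 / c i)).
  by move=> n; apply: bounded_contraction => //; apply: FV; exact: Fle (leq0n n) _ (zF n).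
move=> n; have := zq i n n.+1 (leqnSn n); rewrite /q.
have -> : 8 / c i * 8^-1 ^+ n = (c i)^-1 * (8 * 8^-1 ^+ n) by ring.
rewrite ler_pdivlMl//; lra.
Qed.

(** Weak cluster points of the minimizers [z] are chosen pointwise, without regard to measurability.
    Since the [u i] converge along [z] almost surely, their values at any cluster point are limits
    of measurable functions; these values determine the distances to [D], so [pettis] applies.
    [mazur] keeps the cluster points in the hulls. *)
Lemma weak_limit (x : nat -> strong_elt) : (forall n w, V (x n w)) ->
  exists2 X : strong_elt, (forall w, V (X w)) &
    {ae P, forall w, forall n,
      closed_hull [set x m w | m in [set m | (n <= m)%N]] (X w)}.
Proof.
move=> Vx; pose w0 := point : Omega.
pose v0 := x 0%N w0; have Vv0 : V v0 by exact: Vx.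
have [e [ev0 ex]] := common_separable_range x v0.
have [D [u [De cD cu uD]]] := norming_sequence e.
have eD : range e `<=` range D by move=> _ [j _ <-]; have [i <-] := De j; exists i.
pose H n w := closed_hull [set x m w | m in [set m | (n <= m)%N]].
have H_le m n w : (m <= n)%N -> H n w `<=` H m w.
  by move=> mn; apply: closed_hull_subset => _ [j /= nj <-]; exists j => //=; exact: leq_trans nj.
have HD n w : H n w `<=` closure (range D).
  move=> y; apply=> //; first exact: closed_closure.
  by move=> _ [m _ <-]; apply: closure_subset (ex m w).
pose F n : set strong_elt :=
  [set Z | (forall w, V (Z w)) /\ {ae P, forall w, H n w (Z w)}].
have [|m n mn Z [VZ HZ]|Z []//|n Y Z [VY HY] [VZ HZ]|z [zF zcvg]] :=
    @mean_square_minimizers u F cu.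
- move=> n; exists (x n); split=> //; apply: aeW => w.
  by apply: sub_closed_hull; exists n => /=.
- by split=> //; apply: filterS HZ => w; exact: H_le.
- split; first by apply: V_mix => // w /=; lra.
  move: HZ; apply: filterS2 HY => w HY HZ.
  rewrite mixE; apply: real_convex_closed_hull => //=; lra.
have : {ae P, forall w, (forall n, H n w (z n w)) /\ (forall i, cvgn (fun n => u i (z n w)))}.
  have h1 := ae_forall_nat (fun n => (zF n).2).
  by have := ae_forall_nat zcvg; apply: filterS2 h1 => w.
move=> [N [mN N0 goodN]].
have Vz n w : V (z n w) by have [] := zF n.
have goodP w : ~ N w ->
    (forall n, H n w (z n w)) /\ (forall i, cvgn (fun n => u i (z n w))).
  by move=> Nw; apply: contrapT => h; apply: Nw; exact: goodN.
pose cluster_at w y := V y /\ forall u, contraction u -> forall r : R, 0 < r ->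
  forall n0, exists2 m, (n0 <= m)%N & `|u (z m w) - u y| < r.
(* The value [v0] on the null set [N] lies in the closure of [e], which [common_separable_range] was
   asked to ensure. *)
pose X0 w := if `[< N w >] then v0 else xget v0 (cluster_at w).
have X0N w : N w -> X0 w = v0 by rewrite /X0; case: asboolP.
have X0P w : ~ N w -> cluster_at w (X0 w).
  rewrite /X0; case: asboolP => // _ _; case: xgetP => // h.
  have [y Vy yz] := weakly_compact_cluster wV (fun n => Vz n w).
  by case: (h y).
have VX0 w : V (X0 w).
  by have [/X0N ->//|/X0P[]] := pselect (N w).
have X0H w : ~ N w -> forall n, H n w (X0 w).
  move=> Nw n; have [Hz _] := goodP w Nw; have [_ clX] := X0P w Nw.
  apply: mazur; [by exists (z n w)|exact: closed_closed_hull|exact: real_convex_closed_hull|].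
  move=> f cf r r0; have [m nm] := clX f cf r r0 n; rewrite ltr_norml => /andP[_ h].
  by exists (z m w); [exact: H_le nm _ (Hz m)|lra].
have X0u w i : ~ N w -> u i (z n w) @[n --> \oo] --> u i (X0 w).
  move=> Nw; have [_ cz] := goodP w Nw; have [_ clX] := X0P w Nw.
  suff <- : limn (fun n => u i (z n w)) = u i (X0 w) by exact: cz.
  apply/eqP; rewrite -subr_eq0 -normr_le0; apply/ler_addgt0Pr => r r0; rewrite add0r.
  have r20 : 0 < r / 2 by rewrite divr_gt0.
  have /cvgrPdist_lt/(_ _ r20)[n _ nP] := cz i.
  have [m nm zX] := clX (u i) (cu i) _ r20 n; have /= zl := nP m nm.
  rewrite (le_trans (ler_distD (u i (z m w)) _ _))//.
  by move: zX zl; lra.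
have X0D w : closure (range D) (X0 w).
  have [/X0N ->|Nw] := pselect (N w); first exact: closure_subset ev0.
  exact: HD (X0H w Nw 0%N).
have muX i : measurable_fun setT (fun w => u i (X0 w)).
  apply: (@measurable_fun_cvg _ _ _ _ (fun n w => u i (glue mN (cst_elt Omega v0) (z n) w))).
    by move=> n; exact: (measurable_random _ (continuous_contraction (cu i))).
  move=> w _; have [Nw|Nw] := pselect (N w).
    by rewrite X0N//; under eq_fun do rewrite glue_in//; exact: cvg_cst.
  by under eq_fun do rewrite glue_out//; exact: X0u.
have mX j : measurable_fun setT (fun w => nrm (X0 w - D j)).
  apply: (measurability _ (RGenOInfty.measurableE R)) => _ [_ [r ->] <-].
  rewrite setTI.
  have -> : (fun w => nrm (X0 w - D j)) @^-1` `]r, +oo[ =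
      \bigcup_i (fun w => u i (X0 w)) @^-1` `]r + u i (D j), +oo[.
    apply/seteqP; split=> w /=; rewrite ?in_itv/= ?andbT.
      move=> rX; have [i ri] := uD _ j r (X0D w) rX; exists i => //=.
      by rewrite in_itv/= andbT; lra.
    move=> [i _ /=]; rewrite in_itv/= andbT => h.
    by have := contraction_le (cu i) (X0 w - D j); rewrite contractionB//; lra.
  by apply: bigcup_measurable => i _; rewrite -[X in measurable X]setTI; exact: muX.
have sX := pettis X0D mX.
exists (StrongElt (asboolT sX)) => //.
exists N; split=> // w /= h; apply: contrapT => Nw; apply: h => n.
exact: X0H.
Qed.

End weak_limits.

(** * Arbitrary families *)

Section closing_off.
Context (R : realType) (k : scalar_kind) d (Omega : measurableType d).
Context (P : probability Omega R) (B : normedModType (scalar_field R k)).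
Variables (V : set B) (wV : weakly_compact V) (cV : real_convex V).
Local Notation strong_elt := (strong_elt Omega B).
Local Notation admissible := (admissible P V).
Implicit Types (X Y Z : strong_elt) (G : set strong_elt).

(** With [x n] in the first [n.+1] sets, each [F n] contains a tail of the sequence and hence, by
    [admissible_hull], its weak limit. *)
Lemma admissible_countable_bigcap (F : nat -> set strong_elt) :
  (forall n, admissible (F n)) ->
  (forall n, exists X, forall m, (m <= n)%N -> F m X) -> \bigcap_n F n !=set0.
Proof.
move=> aF /choice[x xF].
have Fx m n : (m <= n)%N -> F m (x n) by move=> mn; exact: xF.
have Vx n w : V (x n w) by have [VF _ _] := aF n; apply: VF; exact: Fx.
have [X VX XH] := weak_limit P wV cV Vx.
exists X => n _; apply: (@admissible_hull _ _ _ _ P _ V _ (fun j => x (n + j)%N)) => //.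
  by move=> j; apply: Fx; exact: leq_addr.
apply: filterS XH => w /(_ n); apply: closed_hull_subset => _ [m /= nm <-].
by exists (m - n)%N => //=; rewrite subnKC.
Qed.

Variable FF : set (set strong_elt).
Hypotheses (aFF : forall G, FF G -> admissible G) (FF0 : FF !=set0).
Hypothesis finFF : forall F : nat -> set strong_elt, (forall n, FF (F n)) ->
  forall n, exists X, forall m, (m <= n)%N -> F m X.

Let FFs : set (set strong_elt) := [set \bigcap_n F n | F in [set F : nat -> set strong_elt | forall n, FF (F n)]].

Let FFs_admissible G : FFs G -> admissible G.
Proof. by move=> [F FFF <-]; apply: admissible_bigcap => n; exact: aFF. Qed.

Let FFs_nonempty G : FFs G -> G !=set0.
Proof.
move=> [F FFF <-]; apply: admissible_countable_bigcap; last exact: finFF.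
by move=> n; exact: aFF.
Qed.

Let FF_FFs G : FF G -> FFs G.
Proof.
move=> FG; exists (fun=> G) => //; apply/seteqP; split=> [X h|X GX n _//].
exact: (h 0%N I).
Qed.

Let FFs_bigcap (F : nat -> set strong_elt) : (forall n, FFs (F n)) -> FFs (\bigcap_n F n).
Proof.
move=> FsF; have /choice[H HP] : forall n, exists H : nat -> set strong_elt,
    (forall m, FF (H m)) /\ \bigcap_m H m = F n.
  by move=> n; have [H FH HF] := FsF n; exists H.
exists (fun p => if unpickle p is Some (n, m) then H n m else H 0%N 0%N).
  by move=> p /=; case: unpickle => [[n m]|]; exact: (HP _).1.
apply/seteqP; split=> X h.
  move=> n _; rewrite -(HP n).2 => m _; have := h (pickle (n, m)) I.
  by rewrite pickleK.
move=> p _; case: unpickle => [[n m]|].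
  by have := h n I; rewrite -(HP n).2; apply.
by have := h 0%N I; rewrite -(HP 0%N).2; apply.
Qed.

Let FFs_setI G G' : FFs G -> FFs G' -> FFs (G `&` G').
Proof.
move=> FG FG'; have := @FFs_bigcap (fun n => if n is 0%N then G else G').
rewrite (_ : \bigcap_n _ = G `&` G'); first by apply; case.
apply/seteqP; split=> X h; first by split; [exact: (h 0%N I)|exact: (h 1%N I)].
by case=> [|n] _; case: h.
Qed.

Let rho G Y : R := inf [set \int[P]_w truncated Z Y w | Z in G].

Let rho_lb Y G : has_lbound [set \int[P]_w truncated Z Y w | Z in G].
Proof.
by exists 0 => _ [Z _ <-]; apply: Rintegral_ge0 => w _; exact: truncated_ge0.
Qed.

Let rho_le G Y Z : G Z -> rho G Y <= \int[P]_w truncated Z Y w.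
Proof. by move=> GZ; apply: ge_inf; [exact: rho_lb|exists Z]. Qed.

Let rho_subset G G' Y : FFs G -> G `<=` G' -> rho G' Y <= rho G Y.
Proof.
move=> /FFs_nonempty[Z GZ] GG; apply: lb_le_inf.
  by exists (\int[P]_w truncated Z Y w), Z.
by move=> _ [W GW <-]; apply: rho_le; exact: GG.
Qed.

Let rho_le1 G Y : FFs G -> rho G Y <= 1.
Proof.
move=> /FFs_nonempty[Z GZ]; apply: le_trans (rho_le Y GZ) _.
have : \int[P]_w truncated Z Y w <= 1 * fine (P setT).
  apply: Rintegral_le_cst => //; first exact: bounded_truncated.
  by move=> w _; rewrite ge_min lexx.
by rewrite probability_setT mulr1.
Qed.

(** [rho] can only grow as the set shrinks, so a maximal [G] is exactly as far from [Y] as its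
    intersection with any member of [FFs]. *)
Let maximal G Y := forall G', FFs G' -> rho G' Y <= rho G Y.

Let maximal_subset G G' Y : FFs G -> G `<=` G' -> maximal G' Y -> maximal G Y.
Proof.
by move=> FG GG mG H FH; exact: le_trans (mG H FH) (rho_subset Y FG GG).
Qed.

(** The supremum of the distances is attained at the intersection of a maximizing sequence, which
    stays in [FFs]. *)
Let maximal_exists1 Y : exists2 G, FFs G & maximal G Y.
Proof.
pose s := sup [set rho G Y | G in FFs].
have [G0 /FF_FFs FG0] := FF0.
have ss : has_sup [set rho G Y | G in FFs].
  split; first by exists (rho G0 Y), G0.
  by exists 1 => _ [G FG <-]; exact: rho_le1.
have /choice[G GP] : forall n, exists G, FFs G /\ s - n.+1%:R^-1 < rho G Y.
  move=> n; have n0 : (0 : R) < n.+1%:R^-1 by rewrite invr_gt0 ltr0n.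
  by have [_ [G FG <-] h] := sup_adherent n0 ss; exists G.
have FGG : FFs (\bigcap_n G n) by apply: FFs_bigcap => n; have [] := GP n.
exists (\bigcap_n G n) => // H FH.
apply: (@le_trans _ _ s); first by apply: sup_upper_bound => //; exists H.
apply/ler_addgt0Pr => e e0.
have [n] := ltr_add_invr e0; rewrite add0r => ne.
have [_ h] := GP n.
have : rho (G n) Y <= rho (\bigcap_n G n) Y by apply: rho_subset => // X; apply.
by move: h ne; set q := n.+1%:R^-1; lra.
Qed.

Let maximal_exists (y : nat -> strong_elt) :
  exists2 G, FFs G & forall j, maximal G (y j).
Proof.
have /choice[G GP] : forall j, exists G, FFs G /\ maximal G (y j).
  by move=> j; have [G FG mG] := maximal_exists1 (y j); exists G.
have FGG : FFs (\bigcap_j G j) by apply: FFs_bigcap => n; have [] := GP n.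
exists (\bigcap_j G j) => // j; apply: (@maximal_subset _ (G j)) => //.
  by move=> X; apply.
by have [] := GP j.
Qed.

Let mix_closed (y : nat -> strong_elt) :=
  forall q a b, exists c, y c = mix (cst (weight R q)) (y a) (y b).

(* One closing-off step: enlarge the countable set y by a point x of G and shrink *)
(* G so that it becomes maximal at every point of the enlarged set.               *)
Let closing_step (s : (nat -> strong_elt) * set strong_elt) : FFs s.2 ->
  exists t : ((nat -> strong_elt) * set strong_elt) * strong_elt,
    [/\ FFs t.1.2, t.1.2 `<=` s.2, s.2 t.2, exists j, t.1.1 j = t.2 &
        [/\ forall i, exists j, t.1.1 j = s.1 i, mix_closed t.1.1 &
            forall j, maximal t.1.2 (t.1.1 j)]].
Proof.
case: s => [y G] /= FG; have [x Gx] := FFs_nonempty FG.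
have [y' [yx' ymix _]] :=
  hull_generators (fun n => if n is m.+1 then y m else x).
have [G' FG' mG'] := maximal_exists y'.
exists ((y', G `&` G'), x); split=> //=; first exact: FFs_setI.
- by have [j] := yx' 0%N; exists j.
- split=> // [i|j]; first by have [j] := yx' i.+1; exists j.
  by apply: (@maximal_subset _ G') => //; exact: FFs_setI.
Qed.

(** The closing-off steps yield [Goo], maximal at all test elements [z j], and a weak limit [X] in
    [Goo] that the [z j] approximate pointwise. Given [H] in [FF], let [Z] in the intersection of
    [H] and [Goo] be nearly nearest to [z j]. On a set where [X] is close to [z j], so is [Z] in the
    mean: otherwise pasting [X] into [Z] there would give an element of [Goo] closer to [z j] than
    maximality allows. Thus members of [H] approximate [X] locally, and [admissible_patch] puts [X]
    in [H]. *)
Lemma admissible_bigcap_nonempty : exists X, (forall w, V (X w)) /\ forall G, FF G -> G X.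
Proof.
have [G0 /FF_FFs FG0] := FF0; have [X0 _] := FFs_nonempty FG0.
pose T := {s : ((nat -> strong_elt) * set strong_elt) * strong_elt | FFs s.1.2}.
pose next (s t : T) :=
  [/\ (sval t).1.2 `<=` (sval s).1.2, (sval s).1.2 (sval t).2,
      exists j, (sval t).1.1 j = (sval t).2,
      forall i, exists j, (sval t).1.1 j = (sval s).1.1 i &
      mix_closed (sval t).1.1 /\ forall j, maximal (sval t).1.2 ((sval t).1.1 j)].
have /choice[step stepP] : forall s : T, exists t : T, next s t.
  move=> [[s x] Fs]; have [t [Ft ts sx tx [st tm tmax]]] := closing_step Fs.
  by exists (exist _ t Ft); split.
pose f n := iter n step (exist _ ((fun=> X0, G0), X0) FG0 : T).
(* Stage 0 holds placeholders without maximality, so [y] and [x] are read one stage later, whereas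
   [G n] is the set from which [x n] was taken. *)
pose y n := (sval (f n.+1)).1.1; pose G n := (sval (f n)).1.2.
pose x n := (sval (f n.+1)).2.
have FsG n : FFs (G n) by exact: svalP (f n).
have nextP n : next (f n) (f n.+1) by exact: stepP.
have Gx n : G n (x n) by have [] := nextP n.
have G_le m n : (m <= n)%N -> G n `<=` G m.
  elim: n => [|n IHn]; first by rewrite leqn0 => /eqP ->.
  rewrite leq_eqVlt => /predU1P[->//|]; rewrite ltnS => /IHn h.
  by apply: subset_trans h; have [] := nextP n.
have y_le m n : (m <= n)%N -> forall i, exists j, y n j = y m i.
  elim: n => [|n IHn]; first by rewrite leqn0 => /eqP -> i; exists i.
  rewrite leq_eqVlt => /predU1P[-> i|]; first by exists i.
  rewrite ltnS => /IHn h i; have [j <-] := h i.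
  by have [_ _ _ yy _] := nextP n.+1; exact: yy.
have Vx n w : V (x n w).
  by have [VG _ _] := FFs_admissible (FsG n); apply: VG; exact: Gx.
have [X VX XH] := weak_limit P wV cV Vx.
pose Goo := \bigcap_n G n.
have FGoo : FFs Goo by exact: FFs_bigcap.
have GooX : Goo X.
  move=> n _; apply: (@admissible_hull _ _ _ _ P _ V _ (fun j => x (n + j)%N)) => //.
  - exact: FFs_admissible.
  - by move=> j; apply: (G_le n (n + j)%N); [exact: leq_addr|exact: Gx].
  - apply: filterS XH => w /(_ n); apply: closed_hull_subset => _ [m /= nm <-].
    by exists (m - n)%N => //=; rewrite subnKC.
pose z p := if unpickle p is Some (n, j) then y n j else y 0%N 0%N.
have zE n j : z (pickle (n, j)) = y n j by rewrite /z pickleK.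
have zP p : exists n j, z p = y n j.
  by rewrite /z; case: unpickle => [[n j]|]; [exists n, j|exists 0%N, 0%N].
have zX : {ae P, forall w, closure (range (fun p => z p w)) (X w)}.
  apply: filterS XH => w /(_ 0%N); apply.
  - exact: closed_closure.
  - apply: mix_closed_convex => q a b.
    (* Any two test elements occur in a common stage, and that stage is closed under rational
       mixtures. *)
    have [m [i ->]] := zP a; have [n [j ->]] := zP b.
    have [i' <-] := y_le _ _ (leq_maxl m n) i.
    have [j' <-] := y_le _ _ (leq_maxr m n) j.
    have [_ _ _ _ [ymix _]] := nextP (maxn m n).
    by have [c yc] := ymix q i' j'; exists (pickle (maxn m n, c)); rewrite zE.
  - move=> _ [n _ <-]; apply: subset_closure.
    have [_ _ [j xj] _ _] := nextP n.
    by exists (pickle (n, j)) => //; rewrite zE /x -xj.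
have zmax p : maximal Goo (z p).
  have [n [j ->]] := zP p; apply: (@maximal_subset _ (G n.+1)) => //.
    by move=> Y GY; exact: (GY n.+1 I).
  by have [_ _ _ _ [_ ymax]] := nextP n; exact: ymax.
exists X; split=> // H FH; apply: (@admissible_patch _ _ _ _ P _ V) => //; first exact: aFF.
move=> e e0; have e20 : 0 < e / 2 by rewrite divr_gt0.
exists (fun j => [set w | nrm ((z j - X) w) < e / 2]); split.
- by move=> j; exact: measurable_nrm_lt.
- apply: negligibleS zX => w /= nw h; apply: nw.
  have [j zj] := (closure_range_enough _ _).1 h _ e20.
  by exists j => //=; rewrite nrm_distC.
move=> j C r mC Cj r0.
have FH' : FFs (H `&` Goo) by apply: FFs_setI => //; exact: FF_FFs.
have [|_ [Z [HZ GZ] <-] Zr] := inf_adherent r0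
    (E := [set \int[P]_w truncated Z (z j) w | Z in H `&` Goo]).
  by split=> //; have [Z HZ] := FFs_nonempty FH'; exists (\int[P]_w truncated Z (z j) w), Z.
exists Z => //.
have b1 := bounded_truncated Z (z j).
have mCC := measurableC mC.
(* X near z j on C competes with Z: the optimality of Goo bounds the loss. *)
have : rho (H `&` Goo) (z j) <= \int[P]_w truncated (glue mC X Z) (z j) w.
  apply: le_trans (zmax j _ FH') _; apply: rho_le.
  exact: (admissible_glue mC (FFs_admissible FGoo) GooX GZ).
rewrite -(setUv C) Rintegral_cat//; [|exact: bounded_truncated|exact: setICr].
rewrite (Rintegral_truncated_glue _ _ _ _ _ _).1// (Rintegral_truncated_glue _ _ _ _ _ _).2//.
move: Zr; rewrite -/(rho _ _) -(setUv C) Rintegral_cat//; last exact: setICr.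
have : \int[P]_(w in C) truncated X (z j) w <= e / 2 * fine (P C).
  apply: Rintegral_le_cst => //; first exact: bounded_truncated.
  by move=> w /Cj /= /ltW h; rewrite ge_min nrm_distC h orbT.
have : \int[P]_(w in C) truncated Z X w <=
    \int[P]_(w in C) truncated Z (z j) w + \int[P]_(w in C) truncated X (z j) w.
  rewrite -RintegralD//; try by apply: bounded_rv_integrable => //; exact: bounded_truncated.
  apply: Rintegral_le => //; first exact: bounded_truncated.
    by apply: bounded_rvD; exact: bounded_truncated.
  by move=> w _; rewrite (truncatedC X); exact: truncated_triangle.
lra.
Qed.

End closing_off.

Lemma convex_set_real_convex (R : realType) (k : scalar_kind)
    (B : normedModType (scalar_field R k)) (V : set B) :
  convex_set V -> real_convex V.
Proof.
move=> cV x y t Vx Vy /andP[t0 t1].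
have k0 : 0 <= of_real k t by rewrite -(of_real0 R k) ler_of_real.
have k1 : of_real k t <= 1 by rewrite -(of_real1 R k) ler_of_real.
have /set_mem := cV x y (Itv01 k0 k1) (mem_set Vx) (mem_set Vy).
by rewrite of_realB of_real1.
Qed.

Section weakly_compact_values.
Context (R : realType) (k : scalar_kind) d (Omega : measurableType d).
Context (P : probability Omega R) (B : normedModType (scalar_field R k)).
Implicit Types (V : set B).

Lemma weakly_compact_L0_convexly_compact V : V !=set0 -> real_convex V ->
  weakly_compact V -> L0_convexly_compact (L0_valued P V).
Proof.
move=> V0 cV wV; split.
- have [v Vv] := V0.
  by exists (\pi_(L0 P B) (cst_elt Omega v)), (cst_elt Omega v).
- exact: L0_convex_L0_valued.
move=> F FP finF.
(* The empty family has the whole space as its intersection, so any element serves. *)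
have [[A0 FA0]|F0] := pselect (F !=set0); last first.
  by exists (\pi_(L0 P B) 0) => A FA; case: F0; exists A.
pose rep (A : set (L0 P B)) : set (strong_elt Omega B) :=
  [set X : strong_elt Omega B | (forall w, V (X w)) /\ A (\pi_(L0 P B) X)].
have [_ [A FA <-]||H HP|X [VX XF]] :=
  @admissible_bigcap_nonempty R k d Omega P B V wV cV (rep @` F).
- have [_ clA cA AV] := FP A FA; split.
  + by move=> X [].
  + move=> xi X Y xi01 [VX AX] [VY AY]; split; last exact: L0_convex_mix.
    by move=> w; rewrite mixE; exact: (cV _ _ _ (VX w) (VY w) (xi01 w)).
  + move=> X VX h; split=> //; apply: mem_closed_L0 => // e e0.
    by have [Y [_ AY] XY] := h e e0; exists Y.
- by exists (rep A0), A0.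
- move=> n; have /choice[A AP] : forall n, exists A, F A /\ rep A = H n.
    by move=> m; have [A FA HA] := HP m; exists A.
  have finA : finite_set [set A m | m in `I_n.+1] by apply: finite_image; exact: finite_II.
  have [A' |x xA] := finF (fset_set [set A m | m in `I_n.+1]).
    by rewrite in_fset_set// inE => -[m _ <-]; rewrite inE; exact: (AP m).1.
  have xAm m : (m <= n)%N -> A m x.
    move=> mn; apply: xA => /=; rewrite in_fset_set// inE; by exists m.
  have [_ _ _ AV] := FP _ (AP 0%N).1.
  have [X VX Xx] := AV x (xAm 0%N (leq0n n)).
  exists X => m mn; rewrite -(AP m).2; split=> //=; rewrite Xx; exact: xAm.
- exists (\pi_(L0 P B) X) => A FA.
  by have [] := XF (rep A) (ex_intro2 _ _ A FA erefl).
Qed.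

End weakly_compact_values.

Theorem theorem2p11 (R : realType) (k : scalar_kind) (d : measure_display)
    (Omega : measurableType d) (P : probability Omega R)
    (B : completeNormedModType (scalar_field R k)) (V : set B) :
  V !=set0 -> closed V -> convex_set V ->
  L0_convexly_compact (L0_valued P V) <-> weakly_compact V.
Proof.
move=> V0 clV /convex_set_real_convex cV; split.
- exact: L0_convexly_compact_weakly_compact.
- exact: weakly_compact_L0_convexly_compact.
Qed.
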